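(* Let $q(t)$, $t\in[0,T]$, be an abnormal sub-Riemannian trajectory corresponding to a control $u\in L^2([0,T],\mathbb{R}^l)$. Then the related control-affine system $(\Sigma^{(1)})$ in $\mathbb{R}\times\mathbb{R}^n\ni(t,q^{(1)})$, namely $$\dot t=1,\qquad \dot q^{(1)}(t)=\sum_{i=1}^l\Delta u_i(t)\cdot\Phi^{(1)}(t)\big[X_i(q(t))\big],\qquad q^{(1)}(0)=0,$$ with controls $\Delta u\in L^2([0,T],\mathbb{R}^l)$, is not controllable at any point $(t,0)$. In particular, there exists an $n$-tuple $(\phi^1,\dots,\phi^n)\in\mathbb{R}^n\setminus\{0\}$ such that the covector $\phi(t)=\sum_{a=1}^n\phi^a\Phi^{(1)}_a(t)\in T^*_{q(t)}M$ satisfies $$\langle\phi(t),X_i(q(t))\rangle=0\quad\text{for all } i=1,2,\dots,l\text{ and all }t\in[0,T].$$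
   Context: $M$ is a smooth $n$-dimensional manifold, $X_1,\dots,X_l$ are smooth, pointwise linearly independent vector fields on $M$, $T>0$ and $q_0\in M$ is fixed. Trajectories are Carathéodory solutions on $[0,T]$ of $\dot q(t)=\sum_{i=1}^lu_i(t)X_i(q(t))$, $q(0)=q_0$, with controls $u\in\Omega=L^2([0,T],\mathbb{R}^l)$; the end-point map is $\mathrm{End}^t(u)=q(t)$ and $D_u\mathrm{End}^T:L^2([0,T],\mathbb{R}^l)\to T_{q(T)}M$ is its derivative at $u$. The trajectory $q(t)$ corresponding to $u$ is called abnormal if the image of $D_u\mathrm{End}^T$ is a proper vector subspace of $T_{q(T)}M$. $\Phi^{(1)}(t)=(\Phi^{(1)}_a(t))_{a=1,\dots,n}:T_{q(t)}M\to\mathbb{R}^n$ is the family of linear maps such that $\{\Phi^{(1)}_a(0)\}_{a=1,\dots,n}$ is a fixed basis of $T^*_{q(0)}M$ and, in local coordinates, $\dot\Phi^{(1)}_a(t)[b]+\sum_{i=1}^lu_i(t)\,\Phi^{(1)}_a(t)\big[D_{q(t)}X_i[b]\big]=0$ for every $b\in T_{q(t)}M$. (This evolution is dual to that induced on $TM$ by the flow of the time-dependent vector field $\sum_iu_i(t)X_i$, and does not depend on the coordinates.) The system $(\Sigma^{(1)})$ is said not to be controllable at $(t,0)$ if the set of all values $q^{(1)}(t)$ reached at time $t$ by its solutions starting from $q^{(1)}(0)=0$ does not contain a neighbourhood of $0$ in $\mathbb{R}^n$. *)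

(* Defs.v *)
From HB Require Import structures.
From mathcomp Require Import all_boot all_order all_algebra.
From mathcomp Require Import all_classical all_reals all_analysis.
Set Implicit Arguments.
Unset Strict Implicit.
Unset Printing Implicit Defensive.
Import Order.TTheory GRing.Theory Num.Theory.
Import numFieldNormedType.Exports.
Local Open Scope classical_set_scope.
Local Open Scope ring_scope.

Section Calculus.
Context {R : realType}.

Fixpoint Ck_on (V W : normedModType R) (k : nat) (U : set V) (f : V -> W) : Prop :=
  match k with
  | 0 => forall x, U x -> {for x, continuous f}
  | k'.+1 => (forall x, U x -> differentiable f x) /\
             (forall v, Ck_on k' U (fun x => 'D_v f x))
  end.

(* Only meant for U open. *)
Definition smooth_on (V W : normedModType R) (U : set V) (f : V -> W) : Prop :=
  forall k, Ck_on k U f.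

Definition abs_continuous (V : normedModType R) (a b : R) (f : R -> V) : Prop :=
  forall e : R, 0 < e -> exists2 d : R, 0 < d &
    forall (m : nat) (x y : 'I_m -> R),
      (forall i, a <= x i /\ x i <= y i /\ y i <= b) ->
      trivIset setT (fun i => `]x i, y i[%classic) ->
      \sum_i (y i - x i) < d -> \sum_i `|f (y i) - f (x i)| < e.

End Calculus.

(* A smooth structure is given by an atlas. [coord c] and [param c] are total
   functions, only meaningful on [dom c] and on its image respectively. *)
Record smooth_manifold (R : realType) (n : nat) (M : topologicalType) :=
  SmoothManifold {
  chart : Type;
  dom : chart -> set M;
  coord : chart -> M -> 'rV[R]_n;
  param : chart -> 'rV[R]_n -> M;
  manifold_hausdorff : hausdorff_space M;
  manifold_second_countable : @second_countable M;
  dom_open : forall c, open (dom c);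
  dom_cover : forall p, exists c, dom c p;
  range_open : forall c, open (coord c @` dom c);
  coordK : forall c p, dom c p -> param c (coord c p) = p;
  coord_continuous : forall c p, dom c p -> {for p, continuous (coord c)};
  param_continuous : forall c y, (coord c @` dom c) y ->
    {for y, continuous (param c)};
  transition_smooth : forall c d,
    smooth_on (coord c @` (dom c `&` dom d)) (coord d \o param c)
}.

Section Tangent.
Context {R : realType} {n : nat} {M : topologicalType}.
Variable A : smooth_manifold R n M.
Implicit Types (p : M) (c d : chart A).

(* T_p M: a tangent vector is the family of its coordinates in the charts at p,
   which transform by the differentials of the transition maps; the coordinates
   in the charts which do not contain p are set to 0. *)
Definition tangent_space p : set (chart A -> 'rV[R]_n) :=
  [set v | (forall c, ~ dom c p -> v c = 0) /\
           (forall c d, dom c p -> dom d p ->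
              v d = 'd (coord d \o param c) (coord c p) (v c))].

(* The element of T_p M with coordinates w in the chart c, for p in dom c. *)
Definition tangent_of_coord c p (w : 'rV[R]_n) : chart A -> 'rV[R]_n :=
  fun d => if `[< dom d p >] then 'd (coord d \o param c) (coord c p) w else 0.

(* T_p^* M: functions whose restriction to T_p M is linear; two such functions
   which agree on T_p M stand for the same covector. *)
Definition cotangent_space p : set ((chart A -> 'rV[R]_n) -> R) :=
  [set w | forall (k : R) v v', tangent_space p v -> tangent_space p v' ->
             w (k *: v + v') = k * w v + w v'].

Definition cotangent_basis p (w : 'I_n -> (chart A -> 'rV[R]_n) -> R) : Prop :=
  (forall a, cotangent_space p (w a)) /\
  (forall z, cotangent_space p z -> exists! k : 'rV[R]_n,
     forall v, tangent_space p v -> z v = \sum_a k 0 a * w a v).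

Definition smooth_vector_field (X : M -> chart A -> 'rV[R]_n) : Prop :=
  (forall p, tangent_space p (X p)) /\
  (forall c, smooth_on (coord c @` dom c) (fun y => X (param c y) c)).

Definition pointwise_independent (l : nat)
    (X : 'I_l -> M -> chart A -> 'rV[R]_n) : Prop :=
  forall p (k : 'I_l -> R), \sum_i k i *: X i p = 0 -> forall i, k i = 0.

End Tangent.

(* Square integrable functions on [0, T], as representatives on the real line;
   their values outside [0, T] are irrelevant. *)
Notation L2 T := (LfunType (mrestr (@lebesgue_measure _) (measurable_itv `[0, T]))
                           (lee1n 2)).
Notation control l T := ('I_l -> L2 T).

Definition control_norm (R : realType) (l : nat) (T : R) (u : control l T) : R :=
  Num.sqrt (\sum_i (fine 'N[mrestr (@lebesgue_measure R) (measurable_itv `[0, T])]_2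
                          [EFin \o u i]) ^+ 2).

Section ControlSystem.
Context {R : realType} {n l : nat} {M : topologicalType}.
Variables (A : smooth_manifold R n M) (X : 'I_l -> M -> chart A -> 'rV[R]_n).
Variables (T : R) (q0 : M).

Definition in_chart (q : R -> M) (c : chart A) (a b : R) : Prop :=
  [/\ 0 <= a, a <= b, b <= T & forall t, a <= t <= b -> dom c (q t)].

(* Carathéodory solutions; only the restriction of q to [0, T] matters. *)
Definition trajectory (u : control l T) (q : R -> M) : Prop :=
  [/\ q 0 = q0,
      {within `[0, T], continuous q} &
      forall c a b, in_chart q c a b ->
        abs_continuous a b (coord c \o q) /\
        {ae (@lebesgue_measure R), forall t, a <= t <= b ->
          is_derive t 1 (coord c \o q) (\sum_i u i t *: X i (q t) c)}].

(* The end-point map u |-> q(t), as a graph: it is a partial function, as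
   the solution corresponding to u need not exist up to time T. *)
Definition endpoint (t : R) (u : control l T) (p : M) : Prop :=
  exists2 q, trajectory u q & q t = p.

(* D is the Fréchet derivative at u of the end-point map End^T, and
   End^T(u) = p; this includes that End^T is defined near u. *)
Definition is_endpoint_derivative (u : control l T) (p : M)
    (D : {linear control l T -> (chart A -> 'rV[R]_n)}) : Prop :=
  [/\ endpoint T u p,
      forall v, tangent_space p (D v) &
      forall c, dom c p ->
        (exists C : R, forall v, `|D v c| <= C * control_norm v) /\
        (forall e : R, 0 < e -> exists2 d : R, 0 < d &
           forall v, control_norm v < d ->
             (exists p', endpoint T (u + v) p') /\
             (forall p', endpoint T (u + v) p' ->
                dom c p' /\
                `|coord c p' - coord c p - D v c| <= e * control_norm v))].

Definition abnormal (u : control l T) (q : R -> M) : Prop :=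
  trajectory u q /\
  exists2 D, is_endpoint_derivative u (q T) D &
             range D `<` tangent_space (q T).

(* The covectors Phi a t = Φ^(1)_a(t); the evolution equation is tested on the
   vectors b with constant coordinates w in a chart. *)
Definition is_Phi1 (u : control l T) (q : R -> M)
    (Phi : 'I_n -> R -> (chart A -> 'rV[R]_n) -> R) : Prop :=
  [/\ forall a t, 0 <= t <= T -> cotangent_space (q t) (Phi a t),
      cotangent_basis (q 0) (fun a => Phi a 0) &
      forall c s r, in_chart q c s r -> forall a (w : 'rV[R]_n),
        abs_continuous s r (fun t => Phi a t (tangent_of_coord c (q t) w)) /\
        {ae (@lebesgue_measure R), forall t, s <= t <= r ->
          is_derive t 1 (fun t => Phi a t (tangent_of_coord c (q t) w))
            (- \sum_i u i t * Phi a t (tangent_of_coord c (q t)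
                 ('d (fun y => X i (param c y) c) (coord c (q t)) w)))}].

Definition Phi1_map (Phi : 'I_n -> R -> (chart A -> 'rV[R]_n) -> R) (t : R)
    (v : chart A -> 'rV[R]_n) : 'rV[R]_n := \row_a Phi a t v.

Definition sigma1_solution (q : R -> M)
    (Phi : 'I_n -> R -> (chart A -> 'rV[R]_n) -> R)
    (du : control l T) (q1 : R -> 'rV[R]_n) : Prop :=
  [/\ q1 0 = 0,
      abs_continuous 0 T q1 &
      {ae (@lebesgue_measure R), forall t, 0 <= t <= T ->
        is_derive t 1 q1 (\sum_i du i t *: Phi1_map Phi t (X i (q t)))}].

Definition sigma1_reachable (q : R -> M)
    (Phi : 'I_n -> R -> (chart A -> 'rV[R]_n) -> R) (t : R) : set 'rV[R]_n :=
  [set y | exists du q1, sigma1_solution q Phi du q1 /\ q1 t = y].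

(* Controllability of (Σ^(1)) at the point (t, 0). *)
Definition sigma1_controllable_at (q : R -> M)
    (Phi : 'I_n -> R -> (chart A -> 'rV[R]_n) -> R) (t : R) : Prop :=
  nbhs (0 : 'rV[R]_n) (sigma1_reachable q Phi t).

End ControlSystem.

(* Main.v *)
Require Import Defs.
From HB Require Import structures.
From mathcomp Require Import all_boot all_order all_algebra.
From mathcomp Require Import all_classical all_reals all_analysis.
From mathcomp Require Import measurable_realfun ring lra.
Set Implicit Arguments.
Unset Strict Implicit.
Unset Printing Implicit Defensive.
Import Order.TTheory GRing.Theory Num.Theory.
Import numFieldNormedType.Exports.
Import Defs.
Local Open Scope classical_set_scope.
Local Open Scope ring_scope.

(* Choose phi <> 0 whose pairing with Phi(T) kills the image of D_u End^T, which
   is possible since that image is a proper subspace, and put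
   phi(t) = sum_a phi^a Phi_a(t). Only one variation of the control is needed:
   v_i(t) = <phi(t), X_i(q(t))>. Let q_e be the trajectory of u + e v. In a chart,
   the linear terms in d/dt <phi(t), q_e(t) - q(t)> cancel by the evolution
   equation of phi, which leaves e |v(t)|^2 up to terms of order e^2 times an
   integrable function; hence <phi(t), q_e(t) - q(t)> = e int_0^t |v|^2 + o(e).
   This survives changes of chart and propagates along [0, T] by induction on the
   real line. At t = T the left-hand side is e <phi(T), D v> + o(e) = o(e), so
   v = 0, which is the second claim. The solutions of (Sigma^(1)) then stay in the
   hyperplane orthogonal to phi, which is the first claim. *)

(** * Absolutely continuous functions *)

(** The control [u] may be unbounded, so drift cannot be measured by elapsed time. The clock is [W],
    the primitive of the sum of the |u_i|, and the steps along [[0, T]] are so short that [W] grows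
    little over each of them, which takes the place of a Gronwall inequality. The derivative of the
    end-point map speaks of time [T] only: that the perturbed curves stay in the charts and within
    O(e) of [q] at earlier times has to be proved. This O(e) bound is carried along with the
    expansion of the pairing, because it is what makes both the quadratic remainder and a change of
    chart cost o(e). Derivatives in time exist only almost everywhere, and every growth estimate is
    drawn from one fact, that an absolutely continuous function with nonnegative derivative almost
    everywhere is nondecreasing. The variation [v] is regular whatever [u] is: it pairs absolutely
    continuous covector coordinates with smooth fields along an absolutely continuous curve, hence
    it is continuous on [[0, T]], bounded there, and an admissible control. *)

Lemma real_induction (R : realType) (a b : R) (P : R -> Prop) :
  P a ->
  (forall t, a <= t < b -> (forall s, a <= s <= t -> P s) ->
     exists2 d, 0 < d & forall s, t < s <= b -> s < t + d -> P s) ->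
  (forall t, a < t <= b -> (forall s, a <= s < t -> P s) -> P t) ->
  forall t, a <= t <= b -> P t.
Proof.
move=> Pa Psucc Plim t0 /andP[at0 t0b]; apply: contrapT => nPt0.
(* The infimum [m] of the failures satisfies [P] by the limit step, and the successor step at [m]
   then keeps failures away from [m]. *)
pose B := [set t | a <= t <= b /\ ~ P t].
have B0 : B !=set0 by exists t0; split=> //; rewrite at0.
have lbB : lbound B a by move=> t [/andP[]].
have hB : has_inf B by split => //; exists a.
pose m := inf B.
have am : a <= m by apply: lb_le_inf.
have mt0 : m <= t0 by apply: ge_inf => //; [exists a | split=> //; rewrite at0].
have mb : m <= b by apply: le_trans t0b.
have Pm' s : a <= s < m -> P s.
  move=> /andP[as_ sm]; apply: contrapT => nPs.
  suff : m <= s by rewrite leNgt sm.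
  apply: ge_inf; first by exists a.
  by split=> //; rewrite as_ (le_trans (ltW sm)).
have Pm : P m.
  move: am; rewrite le_eqVlt => /predU1P[<- //|am].
  by apply: Plim => //; rewrite am.
have Ple s : a <= s <= m -> P s.
  move=> /andP[as_]; rewrite le_eqVlt => /predU1P[->//|sm].
  by apply: Pm'; rewrite as_.
have mlb : m < b.
  rewrite lt_neqAle mb andbT; apply/eqP => mbE.
  by apply: nPt0; apply: Ple; rewrite at0 mbE.
have [|d d0 Pd] := Psucc m _ Ple; first by rewrite am.
have [s [/andP[as_ sb] nPs] smd] := inf_adherent d0 hB.
apply: nPs; have [sm|ms] := leP s m; first by apply: Ple; rewrite as_.
by apply: Pd => //; rewrite ms.
Qed.

Section AbsoluteContinuity.
Context {R : realType}.

(** The common source of the closure properties: sums, products and Lipschitz images all have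
    increments dominated by those of two absolutely continuous functions. *)
Lemma abs_continuous_dom (U V W : normedModType R) (a b C : R)
    (f : R -> U) (g : R -> V) (h : R -> W) : 0 <= C ->
  (forall x y, a <= x -> x <= y -> y <= b ->
     `|h y - h x| <= C * (`|f y - f x| + `|g y - g x|)) ->
  abs_continuous a b f -> abs_continuous a b g -> abs_continuous a b h.
Proof.
move=> C0 hle acf acg e e0.
(* [C + 1] because [C] may be 0; the factor 2 shares [e] between [f] and [g]. *)
have e'0 : 0 < e / (2 * (C + 1)) by rewrite divr_gt0// mulr_gt0// ltr_wpDl.
have [d1 d10 H1] := acf _ e'0; have [d2 d20 H2] := acg _ e'0.
exists (Num.min d1 d2); first by rewrite lt_min d10.
move=> m x y xy dis; rewrite lt_min => /andP[s1 s2].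
have {H1 s1} := H1 _ _ _ xy dis s1; have {H2 s2} := H2 _ _ _ xy dis s2.
set S2 := \sum_i _; set S1 := \sum_i _ => l2 l1.
apply: (@le_lt_trans _ _ (C * (S1 + S2))).
  rewrite mulrDr !mulr_sumr -big_split/=; apply: ler_sum => i _.
  by rewrite -mulrDr; have [? [? ?]] := xy i; exact: hle.
have S10 : 0 <= S1 by apply: sumr_ge0.
have S20 : 0 <= S2 by apply: sumr_ge0.
apply: (@le_lt_trans _ _ ((C + 1) * (S1 + S2))); first by apply: ler_wpM2r; lra.
apply: (@lt_le_trans _ _ ((C + 1) * (e / (2 * (C + 1)) + e / (2 * (C + 1))))).
  by rewrite ltr_pM2l; [exact: ltrD|rewrite ltr_wpDl].
have C1 : C + 1 != 0 by rewrite gt_eqF// ltr_wpDl.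
rewrite le_eqVlt; apply/orP; left; apply/eqP; field.
by rewrite C1.
Qed.

Lemma abs_continuousS (V : normedModType R) (a b a' b' : R) (f : R -> V) :
  a <= a' -> b' <= b -> abs_continuous a b f -> abs_continuous a' b' f.
Proof.
move=> aa bb acf e e0; have [d d0 H] := acf e e0; exists d => // m x y xy.
apply: H => i; have [xa [? yb]] := xy i.
by split; [exact: le_trans xa|split => //; exact: le_trans yb bb].
Qed.

Lemma abs_continuous_unif (V : normedModType R) (a b : R) (f : R -> V) :
  abs_continuous a b f -> forall e, 0 < e -> exists2 d, 0 < d &
    forall x y, a <= x <= b -> a <= y <= b -> `|y - x| < d ->
      `|f y - f x| < e.
Proof.
move=> acf e e0; have [d d0 H] := acf e e0; exists d => // x y.
wlog xy : x y / x <= y.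
  move=> W xab yab; have [xy|/ltW yx] := leP x y; first exact: W.
  by rewrite distrC (distrC (f y)) => ?; exact: W.
move=> /andP[ax xb] /andP[ay yb]; rewrite ger0_norm ?subr_ge0// => yx.
(* Uniform continuity is the case of a single interval. *)
have := H 1 (fun=> x) (fun=> y); rewrite !big_ord1; apply => //.
by move=> i j _ _ _; rewrite (ord1 i) (ord1 j).
Qed.

Lemma abs_continuous_bounded (V : normedModType R) (a b : R) (f : R -> V) :
  abs_continuous a b f -> exists2 C, 0 <= C & forall t, a <= t <= b -> `|f t| <= C.
Proof.
move=> /abs_continuous_unif /(_ 1 ltr01)[d d0 H].
(* The bound is claimed on all of [[a, t]], so that real induction can pass it on; each step of
   length less than [d] raises it by at most 1. *)
suff Hb : forall t, a <= t <= b -> exists2 C, 0 <= C & forall s, a <= s <= t -> `|f s| <= C.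
  have [ab|ba] := leP a b; first by apply: Hb; rewrite ab lexx.
  exists 0 => // t /andP[at_ tb]; have := le_trans at_ tb.
  by rewrite leNgt ba.
apply: real_induction.
- exists `|f a| => // s /andP[? ?]; suff -> : s = a by [].
  by apply/eqP; rewrite eq_le; apply/andP.
- move=> t /andP[at_ tb] Ht; exists d => // s /andP[ts sb] std.
  have [|C C0 HC] := Ht t; first by rewrite at_ lexx.
  exists (C + 1); first by rewrite addr_ge0.
  move=> r /andP[ar rs]; have [rt|tr] := leP r t.
    by apply: (le_trans (HC r _)); rewrite ?ar// lerDl.
  rewrite -(subrK (f t) (f r)) addrC; apply: (le_trans (ler_normD _ _)).
  apply: lerD; first by apply: HC; rewrite at_ lexx.
  apply/ltW/H; rewrite ?at_ ?ar ?(ltW tb) ?(le_trans rs)//.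
  by rewrite ger0_norm ?subr_ge0 ?(ltW tr)//; lra.
- move=> t /andP[at_ tb] Ht.
  pose s := Num.max a (t - d / 2).
  have st : s < t by rewrite gt_max at_ /=; lra.
  have as_ : a <= s by rewrite le_max lexx.
  have [|C C0 HC] := Ht s; first by rewrite as_.
  exists (C + 1); first by rewrite addr_ge0.
  move=> r /andP[ar rt]; have [rs|sr] := leP r s.
    by apply: (le_trans (HC r _)); rewrite ?ar// lerDl.
  rewrite -(subrK (f s) (f r)) addrC; apply: (le_trans (ler_normD _ _)).
  apply: lerD; first by apply: HC; rewrite as_ lexx.
  apply/ltW/H; rewrite ?as_ ?ar ?(le_trans rt)//= ?(le_trans (ltW st))//.
  have : t - d / 2 <= s by rewrite le_max lexx orbT.
  by rewrite ger0_norm ?subr_ge0 ?(ltW sr)//; lra.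
Qed.

End AbsoluteContinuity.

(** * Growth of absolutely continuous functions from their derivatives almost everywhere *)

Section MonotoneAbsoluteContinuity.
Context {R : realType}.

(** A form of the derivative free of division, which with its converse [derive1_approx_at] lets
    derivatives be transferred along plain norm inequalities. *)
Lemma is_derive1_approx (V : normedModType R) (f : R -> V) (t : R) (d : V) :
  is_derive t 1 f d -> forall e, 0 < e -> exists2 r, 0 < r &
    forall s, `|s - t| < r -> `|f s - f t - (s - t) *: d| <= e * `|s - t|.
Proof.
case=> df dE e e0.
have : h^-1 *: ((f \o shift t) (h *: 1) - f t) @[h --> 0^'] --> d.
  by rewrite -dE; exact: df.
move=> /cvgrPdist_le /(_ e e0) /nbhs_ballP[r /= r0 H].
exists r => // s sr; have [->|st] := eqVneq s t.
  by rewrite !subrr scale0r subrr !normr0 mulr0.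
have st0 : s - t != 0 by rewrite subr_eq0.
have := H (s - t); rewrite /ball/= sub0r normrN => /(_ sr st0).
rewrite /= -[(s - t) *: 1]/((s - t) * 1) mulr1 subrK => /(ler_wpM2r (normr_ge0 (s - t))).
rewrite distrC mulrC -normrZ scalerBr scalerA mulfV// scale1r.
exact: le_trans.
Qed.

Lemma derive1_approx_at (V : normedModType R) (f : R -> V) (t : R) (d : V) :
  (forall e, 0 < e -> exists2 r, 0 < r &
    forall s, `|s - t| < r -> `|f s - f t - (s - t) *: d| <= e * `|s - t|) ->
  is_derive t 1 f d.
Proof.
move=> H.
have c : h^-1 *: ((f \o shift t) (h *: 1) - f t) @[h --> 0^'] --> d.
  apply/cvgrPdist_le => e e0; have [r r0 Hr] := H e e0.
  apply/nbhs_ballP; exists r => //= h; rewrite /ball/= sub0r normrN => hr h0.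
  rewrite -[h *: 1]/(h * 1) mulr1 distrC.
  have := Hr (h + t); rewrite addrK => /(_ hr) H'.
  have h0' : 0 < `|h| by rewrite normr_gt0.
  rewrite -(ler_pM2l h0') -normrZ scalerBr scalerA mulfV// scale1r mulrC.
  by rewrite (mulrC e) in H' *.
split; first by apply/cvg_ex; exists d.
exact: cvg_lim c.
Qed.

Lemma ae_sub (P Q : R -> Prop) : {ae (@lebesgue_measure R), forall t, P t} ->
  (forall t, P t -> Q t) -> {ae (@lebesgue_measure R), forall t, Q t}.
Proof.
move=> aeP PQ; apply: filterS aeP; last exact: PQ.
exact: (ae_filter_ringOfSetsType (@lebesgue_measure R)).
Qed.

Lemma ae_and (P Q : R -> Prop) : {ae (@lebesgue_measure R), forall t, P t} ->
  {ae (@lebesgue_measure R), forall t, Q t} ->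
  {ae (@lebesgue_measure R), forall t, P t /\ Q t}.
Proof.
move=> aeP aeQ; apply: filterI aeP aeQ.
exact: (ae_filter_ringOfSetsType (@lebesgue_measure R)).
Qed.

Lemma sum_itv_le_measure (m : nat) (x y : 'I_m -> R) (U : set R) :
  (forall i, x i <= y i) -> trivIset setT (fun i => `]x i, y i[%classic) ->
  measurable U -> (forall i, `]x i, y i[%classic `<=` U) ->
  ((\sum_i (y i - x i))%:E <= lebesgue_measure U)%E.
Proof.
move=> xy dis mU sU.
have -> : (\sum_i (y i - x i))%:E =
    lebesgue_measure (\big[setU/set0]_(i < m) `]x i, y i[%classic).
  rewrite measure_bigsetU_ord//= -sumEFin; apply: eq_bigr => i _.
  rewrite lebesgue_measure_itv/= lte_fin -EFinB; case: ltP => // yx.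
  by rewrite (_ : y i = x i) ?subrr//; apply/eqP; rewrite eq_le yx xy.
apply: le_measure; rewrite ?inE//; first by apply: bigsetU_measurable => i _; exact: measurable_itv.
by apply: (big_ind (fun S => S `<=` U)) => [z []|A B AU BU|i _]; rewrite ?subUset.
Qed.

(* Outside a null set the derivative controls the increments of f; the null set
   is covered by an open set of small measure, over which absolute continuity
   controls them. *)
Lemma abs_continuous_nondecreasing (a b : R) (f : R -> R) :
  abs_continuous a b f ->
  {ae (@lebesgue_measure R), forall t, a <= t <= b ->
     exists2 d, 0 <= d & is_derive t 1 f d} ->
  a <= b -> f a <= f b.
Proof.
move=> acf [A [mA A0 subA]] ab.
apply/ler_addgt0Pr => e' e'0.
(* The total loss is [e * (b - a)] from the slope and [e] from the exceptional intervals, which adds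
   up to [e']. *)
pose e := e' / (b - a + 1).
have ba1 : 0 < b - a + 1 by rewrite ltr_wpDl ?subr_ge0.
have e0 : 0 < e by rewrite divr_gt0.
have [d d0 Hd] := acf e e0.
have [|U [oU AU muU]] := lebesgue_regularity_outer mA _ d0; first by rewrite [ltLHS]A0.
have mU : measurable U by exact: measurable_realfun.open_measurable.
have Ud : (lebesgue_measure U < d%:E)%E.
  rewrite -(setDUK AU) measureU//; last 2 first.
    exact: measurableD.
    by rewrite setDE setICA setICr setI0.
  by rewrite [X in (X + _)%E]A0 add0e.
(* Up to [t], the decrease of [f] is paid for by a slope [e] and by the variation of [f] over
   finitely many disjoint intervals inside [U], collected as the induction advances. *)
pose Q t := exists m, exists x : 'I_m -> R, exists y : 'I_m -> R,
  [/\ forall i, [/\ a <= x i, x i <= y i & y i <= t],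
      trivIset setT (fun i => `]x i, y i[%classic),
      forall i, `]x i, y i[%classic `<=` U &
      f a - f t <= e * (t - a) + \sum_i `|f (y i) - f (x i)|].
have Qext s t : a <= s -> s <= t -> Q s ->
    f s - f t <= e * (t - s) \/ `]s, t[%classic `<=` U -> Q t.
  move=> as_ st [m [x [y [xy dis sU le]]]] [inc|stU].
    exists m, x, y; split => //; first by move=> i; have [? ? /le_trans ->] := xy i.
    by move: le inc; lra.
  (* The new interval []s, t[] takes index [ord0] and the old ones are shifted; it is disjoint from
     them since they all end by [s]. *)
  exists m.+1.
  exists (fun i => if unlift ord0 i is Some j then x j else s).
  exists (fun i => if unlift ord0 i is Some j then y j else t).
  split.
  - move=> i; case: unliftP => [j _|_]; last by [].
    by have [? ? /le_trans ->] := xy j.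
  - move=> i j _ _.
    have D k z : x k < z < y k -> s < z < t -> False.
      move=> /andP[_ zy] /andP[sz _]; have [_ _] := xy k; rewrite leNgt => /negP; apply.
      exact: lt_trans sz zy.
    case: unliftP => [i'|] ->; case: unliftP => [j'|] -> //=.
    + by move=> /(dis i' j' I I) ->.
    + by move=> [z []] /=; rewrite !in_itv/= => /D /[apply].
    + by move=> [z []] /=; rewrite !in_itv/= => h /D /(_ h).
  - by move=> i; case: unliftP => [j _|_].
  - rewrite big_ord_recl unlift_none.
    under eq_bigr do rewrite liftK.
    have : f s - f t <= `|f t - f s| by rewrite distrC ler_norm.
    have : e * (s - a) <= e * (t - a) by rewrite ler_pM2l// lerD2r.
    by move: le; lra.
(* Near a point of the null set one stays inside the open set [U]; near any other point the
   nonnegative derivative gives the slope bound. *)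
have Qloc t : a <= t <= b -> exists2 r, 0 < r & forall s, `|s - t| < r ->
    (s <= t -> f s - f t <= e * (t - s) \/ `]s, t[%classic `<=` U) /\
    (t <= s -> f t - f s <= e * (s - t) \/ `]t, s[%classic `<=` U).
  move=> tab; have [At|nAt] := pselect (A t).
    have /nbhs_ballP[r /= r0 rU] : nbhs t U by apply: open_nbhs_nbhs; split => //; exact: AU.
    exists r => // s; rewrite ltr_norml => /andP[sr1 sr2].
    split => ts; right => z; rewrite /= in_itv/= => /andP[z1 z2];
      by apply: rU; rewrite /ball/= ltr_norml; apply/andP; split; lra.
  have [c c0 /is_derive1_approx/(_ _ e0)[r r0 H]] : exists2 d, 0 <= d & is_derive t 1 f d.
    by apply: contrapT => nd; apply: nAt; apply: subA => /= /(_ tab).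
  exists r => // s /H; rewrite -[_ *: _]/(_ * _) ler_norml => /andP[h1 h2]; split => st; left.
    move: h2; rewrite ler0_norm ?subr_le0//.
    have : (s - t) * c <= 0 by rewrite mulr_le0_ge0// subr_le0.
    by lra.
  move: h1; rewrite ger0_norm ?subr_ge0//.
  have : 0 <= (s - t) * c by rewrite mulr_ge0// subr_ge0.
  by lra.
have Qb : forall t, a <= t <= b -> Q t.
  apply: real_induction.
  - exists 0%N, (fun=> 0), (fun=> 0); split; try by case.
    by rewrite big_ord0 !subrr mulr0 addr0.
  - move=> t /andP[at_ tb] Qt; have [|r r0 H] := Qloc t; first by rewrite at_ ltW.
    exists r => // s /andP[ts sb] sr.
    apply: (Qext t) => //; first exact: ltW; first by apply: Qt; rewrite at_ lexx.
    have [|_ h] := H s; first by rewrite ger0_norm ?subr_ge0 ?(ltW ts)//; lra.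
    exact/h/ltW.
  - move=> t /andP[at_ tb] Qt; have [|r r0 H] := Qloc t; first by rewrite ltW.
    pose s := Num.max a (t - r / 2).
    have st : s < t by rewrite gt_max at_ /=; lra.
    have as_ : a <= s by rewrite le_max lexx.
    apply: (Qext s) => //; first exact: ltW; first by apply: Qt; rewrite as_.
    have : t - r / 2 <= s by rewrite le_max lexx orbT.
    move=> st'; have [|h _] := H s; first by rewrite ler0_norm ?subr_le0 ?(ltW st)//; lra.
    exact/h/ltW.
have [|m [x [y [xy dis sU le]]]] := Qb b; first by rewrite ab lexx.
have : \sum_i `|f (y i) - f (x i)| < e.
  apply: Hd => //; first by move=> i; have [] := xy i.
  rewrite -lte_fin (le_lt_trans _ Ud)//; apply: sum_itv_le_measure => // i.
  by have [] := xy i.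
have -> : e' = e * (b - a + 1) by rewrite divfK// gt_eqF.
by move: le; lra.
Qed.

(** Both [g - f] and [g + f] are nondecreasing. In use, [g] is an explicit majorant, so no
    derivative has to be integrated. *)
Lemma abs_continuous_le (a b : R) (f g : R -> R) :
  abs_continuous a b f -> abs_continuous a b g ->
  {ae (@lebesgue_measure R), forall t, a <= t <= b ->
     exists df, exists dg, [/\ is_derive t 1 f df, is_derive t 1 g dg &
       `|df| <= dg]} ->
  a <= b -> `|f b - f a| <= g b - g a.
Proof.
move=> acf acg H ab.
have F : forall c : R, c ^+ 2 = 1 -> c * (f b - f a) <= g b - g a.
  move=> c c2.
  have cn : `|c| = 1 by apply/eqP; rewrite -sqrp_eq1// -normrX c2 normr1.
  have : g a - c * f a <= g b - c * f b.
    apply: (@abs_continuous_nondecreasing a b (fun t => g t - c * f t)) => //.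
      apply: (@abs_continuous_dom _ _ _ _ _ _ 1 f g) => // x y _ _ _.
      have -> : g y - c * f y - (g x - c * f x) = (g y - g x) - c * (f y - f x) by ring.
      by rewrite mul1r (addrC `|f y - f x|) (le_trans (ler_normB _ _))// normrM cn mul1r.
    apply: ae_sub H _ => t /[swap] tab /(_ tab)[df [dg [Df Dg le]]].
    exists (dg - c * df); last first.
      by apply: is_deriveB; exact: (@is_deriveZ _ _ _ f c).
    rewrite subr_ge0 (le_trans (ler_norm _))// normrM cn mul1r//.
  by lra.
rewrite ler_norml; apply/andP; split.
  by have := F (-1); rewrite sqrrN expr1n => /(_ erefl); lra.
by have := F 1; rewrite expr1n => /(_ erefl); lra.
Qed.

End MonotoneAbsoluteContinuity.

(** * Primitives of integrable functions, and square integrable functions *)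

Section Primitive.
Context {R : realType}.
Notation mu := (@lebesgue_measure R).

Lemma integrable_primitive (a b : R) (g : R -> R) :
  mu.-integrable `[a, b] (EFin \o g) ->
  exists G : R -> R, [/\ G a = 0, abs_continuous a b G &
    {ae mu, forall t, a <= t <= b -> is_derive t 1 G (g t)}].
Proof.
(* Extension by 0 makes the function integrable on the whole line, as the primitive from minus
   infinity requires. *)
move=> intg; pose g' := g \_ `[a, b].
have intg' : mu.-integrable setT (EFin \o g').
  by rewrite /g' -restrict_EFin; apply/integrable_restrict => //; rewrite setTI.
have intg'S (A : set R) : measurable A -> mu.-integrable A (EFin \o g').
  by move=> mA; apply: integrableS intg'.
pose F x := (\int[mu]_(t in [set` `]-oo, x]]) (g' t)).
have FB x y : x <= y -> F y - F x = \int[mu]_(t in `]x, y]) g' t.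
  by move=> xy; rewrite /F Rintegral_itvB ?bnd_simp//; exact: intg'S.
exists (fun x => F x - F a); split; first exact: subrr.
- move=> e e0; have [d [d0 Hd]] := integral_normr_continuous intg' e0.
  exists d => // m x y xy dis sd.
  (* Absolute continuity is the smallness of the integral over sets of small measure, applied to the
     union of the intervals. *)
  pose D := \big[setU/set0]_(i <- index_enum 'I_m) `]x i, y i[%classic.
  have mD : measurable D by apply: bigsetU_measurable => i _; exact: measurable_itv.
  have DE : (\sum_i (y i - x i))%:E = mu D.
    rewrite /D measure_bigsetU_ord//= -sumEFin; apply: eq_bigr => i _.
    have [_ [xyi _]] := xy i.
    rewrite lebesgue_measure_itv/= lte_fin -EFinB; case: ltP => // yx.
    by rewrite (_ : y i = x i) ?subrr//; apply/eqP; rewrite eq_le yx xyi.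
  have /(Hd D mD) : (mu D < d%:E)%E by rewrite -DE lte_fin.
  apply: le_lt_trans.
  rewrite /Rintegral integral_bigsetU_EFin//=; last 3 first.
  - exact: index_enum_uniq.
  - exact: sub_trivIset dis.
  - apply/measurable_EFinP; apply: measurableT_comp => //.
    by apply/measurable_EFinP; apply: measurable_int (intg'S _ mD).
  rewrite -EFin_sum_fine/=; last first.
    move=> i _; apply: integrable_fin_num => //.
    by apply: (integrable_abse (intg'S _ _)).
  apply: ler_sum => i _; have [_ [xyi _]] := xy i.
  rewrite opprB addrA subrK FB// -Rintegral_itv_bndo_bndc; last exact: intg'S.
  by apply: le_normr_Rintegral => //; exact: intg'S.
- have loc : locally_integrable [set: R] g'.
    by apply: open_integrable_locally => //; exact: openT.
  have := FTC1Ny (fun y => intg'S `]-oo, y]%classic (measurable_itv _)) loc.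
  move=> /ae_sub; apply => t [dF F't] tab.
  have -> : g t = g' t by rewrite /g' patchE mem_set//= in_itv.
  rewrite -F't derive1E.
  rewrite -[X in is_derive _ _ _ X]subr0.
  by apply: is_deriveB; exact/derivableP.
Qed.

Lemma mrestr_integrable (a b : R) (f : R -> R) :
  (mrestr mu (measurable_itv `[a, b])).-integrable setT (EFin \o f) ->
  mu.-integrable `[a, b] (EFin \o f).
Proof.
set nu := mrestr _ _ => intf.
have : nu.-integrable `[a, b] (EFin \o f) by apply: integrableS intf.
move=> /integrableP[mf fin]; apply/integrableP; split => //.
apply: le_lt_trans fin; rewrite le_eqVlt; apply/orP; left; apply/eqP.
apply: eq_measure_integral => A mA AD.
by rewrite /nu/= /mrestr setIidl.
Qed.

Lemma L2_integrable (a : R) (f : LfunType (mrestr mu (measurable_itv `[0, a])) (lee1n 2)) :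
  mu.-integrable `[0, a] (EFin \o f).
Proof.
apply: mrestr_integrable; apply/Lfun1_integrable.
apply: Lfun_subset12; last exact: LfunP.
rewrite /= /mrestr setTI lebesgue_measure_itv/=; by case: ifP.
Qed.

Lemma bounded_L2 (a C : R) (f : R -> R) : measurable_fun setT f ->
  (forall t, `|f t| <= C) ->
  exists v : LfunType (mrestr mu (measurable_itv `[0, a])) (lee1n 2), f = v.
Proof.
move=> mf fC.
have fP : f \in Lfun (mrestr mu (measurable_itv `[0, a])) 2%:E.
  rewrite inE; apply/andP; split; first by rewrite inE.
  rewrite inE/= /finite_norm unlock /Lnorm poweR_lty//.
  apply: (@le_lt_trans _ _ (\int[mrestr mu (measurable_itv `[0%R, a])]_x (powR C 2)%:E)%E).
    apply: ge0_le_integral => //.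
    - move=> x _; exact: poweR_ge0.
    - apply/measurable_EFinP.
      apply: (@measurableT_comp _ _ _ _ _ _ (@powR R ^~ 2)) => //.
      exact: measurableT_comp.
    - move=> x _ /=; rewrite lee_fin ge0_ler_powR ?nnegrE//.
      exact: le_trans (fC x).
  rewrite integral_cst//= /mrestr setTI lebesgue_measure_itv/=.
  by case: ifP => _; rewrite ?mule0 ?ltry// -EFinB -EFinM ltry.
by exists (Lfun_Sub (lee1n 2) fP).
Qed.

End Primitive.

(** * Calculus on row vectors *)

Section RowVectorCalculus.
Context {R : realType}.

Lemma coord_le_norm n (v : 'rV[R]_n) k : `|v 0 k| <= `|v|.
Proof.
rewrite -[leRHS]/(mx_norm v) mx_normrE.
exact: (le_bigmax_cond _ (fun ij => `|v ij.1 ij.2|) (isT : xpredT (0, k))).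
Qed.

Lemma norm_le_coord n (v : 'rV[R]_n) (B : R) : 0 <= B ->
  (forall k, `|v 0 k| <= B) -> `|v| <= B.
Proof.
move=> B0 vB; rewrite -[leLHS]/(mx_norm v) mx_normrE; apply/bigmax_leP; split => //.
by move=> [i k] _ /=; rewrite (ord1 i).
Qed.

Lemma is_derive_coord n (f : R -> 'rV[R]_n) (t : R) (d : 'rV[R]_n) k :
  is_derive t 1 f d -> is_derive t 1 (fun s => f s 0 k) (d 0 k).
Proof.
move=> /is_derive1_approx df; apply: derive1_approx_at => e e0.
have [r r0 H] := df e e0; exists r => // s /H; apply: le_trans.
have -> : f s 0 k - f t 0 k - (s - t) *: d 0 k = (f s - f t - (s - t) *: d) 0 k.
  by rewrite !mxE.
exact: coord_le_norm.
Qed.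

Lemma is_derive_diff_comp (V W : normedModType R) (f : V -> W) (g : R -> V) t d :
  differentiable f (g t) -> is_derive t 1 g d ->
  is_derive t 1 (f \o g) ('d f (g t) d).
Proof.
move=> df [/derivable1_diffP dg <-].
have dfg : differentiable (f \o g) t by exact: differentiable_comp.
split; first exact: diff_derivable.
by rewrite deriveE// diff_comp//= (deriveE _ dg).
Qed.

(** [Ck_on] gives regularity of directional derivatives, while the estimates concern the
    differential; this identity passes from one to the other. *)
Lemma diff_row_sum n (W : normedModType R) (f : 'rV[R]_n -> W) y h :
  differentiable f y ->
  'd f y h = \sum_j h 0 j *: 'D_(delta_mx 0 j) f y.
Proof.
move=> df; rewrite {1}(row_sum_delta h) linear_sum; apply: eq_bigr => j _.
by rewrite linearZ/= deriveE.
Qed.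

(** The norm of a row vector is the maximum of its entries, so the scalar mean value theorem in each
    coordinate loses no constant. *)
Lemma curve_mean_value m (g : R -> 'rV[R]_m) (dg : R -> 'rV[R]_m) (B : R) :
  (forall s : R, 0 <= s <= 1 -> is_derive s 1 g (dg s)) ->
  (forall s : R, 0 <= s <= 1 -> `|dg s| <= B) ->
  `|g 1 - g 0| <= B.
Proof.
move=> Dg dB.
have B0 : 0 <= B by apply: le_trans (dB 0 _); rewrite ?lexx ?ler01.
apply: norm_le_coord => // k.
have Dgk (s : R) : 0 <= s <= 1 -> is_derive s 1 (fun s => g s 0 k) (dg s 0 k).
  by move=> /Dg; exact: is_derive_coord.
have [||c] := @MVT_segment R (fun s => g s 0 k) (fun s => dg s 0 k) 0 1 ler01.
- by move=> s; rewrite in_itv/= => /andP[s0 s1]; apply: Dgk; rewrite !ltW.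
- apply: derivable_within_continuous => s; rewrite in_itv/= => s01.
  by have [] := Dgk s s01.
rewrite in_itv/= => c01; rewrite subr0 mulr1 !mxE => ->.
by apply: le_trans (dB c c01); exact: coord_le_norm.
Qed.

Lemma is_derive_line (V W : normedModType R) (f : V -> W) y h (s : R) :
  differentiable f (y + s *: h) ->
  is_derive s 1 (fun s : R => f (y + s *: h)) ('d f (y + s *: h) h).
Proof.
move=> df; have dline : is_derive s 1 (fun s : R => y + s *: h) h.
  apply: derive1_approx_at => e e0; exists 1 => // s' _.
  rewrite opprD addrACA subrr add0r -scalerBl subrr normr0.
  by rewrite mulr_ge0// ltW.
exact: (is_derive_diff_comp (g := fun s : R => y + s *: h)).
Qed.

Lemma closed_cball (V : normedModType R) (y0 : V) (r : R) :
  closed [set y | `|y - y0| <= r].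
Proof.
apply: (@closed_comp _ _ (fun y => `|y - y0|) [set x | x <= r]); last exact: closed_le.
move=> y _; apply: cvg_norm; apply: cvgB; [exact: cvg_id|exact: cvg_cst].
Qed.

Lemma compact_cball n (y0 : 'rV[R]_n) (r : R) : compact [set y | `|y - y0| <= r].
Proof.
apply: bounded_closed_compact; last exact: closed_cball.
exists (`|y0| + r); split; first by rewrite num_real.
move=> M rM y /= yr; apply/ltW/(le_lt_trans _ rM).
by rewrite -(subrK y0 y) addrC (le_trans (ler_normD _ _))// lerD2l.
Qed.

Lemma cball_segment (V : normedModType R) (y0 y h : V) (r s : R) : 0 <= s <= 1 ->
  `|y - y0| <= r -> `|y + h - y0| <= r -> `|y + s *: h - y0| <= r.
Proof.
move=> /andP[s0 s1] yr yhr.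
have -> : y + s *: h - y0 = (1 - s) *: (y - y0) + s *: (y + h - y0).
  by rewrite scalerBl scale1r -addrAC (addrAC y h) (scalerDr _ (y - y0)) addrA subrK addrAC.
rewrite (le_trans (ler_normD _ _))// !normrZ (ger0_norm s0) ger0_norm ?subr_ge0//.
have -> : r = (1 - s) * r + s * r by ring.
by apply: lerD; apply: ler_wpM2l => //; rewrite subr_ge0.
Qed.

(* The differentials enter through the equations on a and b: rewriting in a goal
   with two differentials at different points makes unification diverge. *)
Lemma norm_diffB_le n m (f : 'rV[R]_n -> 'rV[R]_m) y z h a b :
  differentiable f y -> differentiable f z ->
  a = 'd f z h -> b = 'd f y h ->
  `|a - b| <=
    (\sum_j `|'D_(delta_mx 0 j) f z - 'D_(delta_mx 0 j) f y|) * `|h|.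
Proof.
move=> dfy dfz eqa eqb.
rewrite (etrans eqa (diff_row_sum h dfz)) (etrans eqb (diff_row_sum h dfy)).
rewrite -sumrB mulr_suml.
apply: (le_trans (ler_norm_sum _ _ _)); apply: ler_sum => j _.
by rewrite -scalerBr normrZ mulrC ler_wpM2l// coord_le_norm.
Qed.

Section Ball.
Variables (n m : nat) (U : set 'rV[R]_n) (y0 : 'rV[R]_n) (r : R).
Hypothesis r0 : 0 <= r.
Hypothesis BU : forall y, `|y - y0| <= r -> U y.

Lemma continuous_bounded_cball (f : 'rV[R]_n -> 'rV[R]_m) :
  (forall y, U y -> {for y, continuous f}) ->
  exists2 B, 0 <= B & forall y, `|y - y0| <= r -> `|f y| <= B.
Proof.
move=> cf.
have [||c _ H] := @EVT_max_rV R n (fun y => `|f y|) [set y | `|y - y0| <= r] _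
    (@compact_cball _ _ _).
- by exists y0; rewrite /= subrr normr0.
- apply: continuous_in_subspaceT => y; rewrite inE/= => /BU /cf cfy.
  exact: cvg_norm cfy.
exists `|f c| => // y yr; apply: H; rewrite inE; exact: yr.
Qed.

(** Partial derivatives are bounded on the compact ball, and the ball is convex, so the mean value
    inequality applies along the segment from [y] to [y']. *)
Lemma C1_lipschitz_cball (f : 'rV[R]_n -> 'rV[R]_m) : Ck_on 1 U f ->
  exists2 L, 0 <= L & forall y y', `|y - y0| <= r -> `|y' - y0| <= r ->
    `|f y' - f y| <= L * `|y' - y|.
Proof.
move=> [df cdf].
have /choice[B HB] : forall j : 'I_n, exists B, 0 <= B /\
    forall y, `|y - y0| <= r -> `|'D_(delta_mx 0 j) f y| <= B.
  by move=> j; have [B] := continuous_bounded_cball (cdf (delta_mx 0 j)); exists B.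
exists (\sum_j B j); first by apply: sumr_ge0 => j _; have [] := HB j.
move=> y y' yr y'r; set h := y' - y.
have y'E : y + h = y' by rewrite /h addrC subrK.
have sr (s : R) : 0 <= s <= 1 -> `|y + s *: h - y0| <= r.
  by move=> s01; apply: cball_segment => //; rewrite y'E.
have := @curve_mean_value _ (fun s : R => f (y + s *: h))
  (fun s : R => 'd f (y + s *: h) h).
rewrite scale1r scale0r addr0 y'E; apply => s s01.
  by apply: is_derive_line; exact/df/BU/sr.
rewrite diff_row_sum; last exact/df/BU/sr.
rewrite (le_trans (ler_norm_sum _ _ _))// mulr_suml; apply: ler_sum => j _.
rewrite normrZ mulrC; apply: ler_pM => //; last exact: coord_le_norm.
by have [_] := HB j; apply; exact: sr.
Qed.

Lemma C2_taylor_cball (f : 'rV[R]_n -> 'rV[R]_m) : Ck_on 2 U f ->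
  exists2 C, 0 <= C & forall y y', `|y - y0| <= r -> `|y' - y0| <= r ->
    `|f y' - f y - 'd f y (y' - y)| <= C * `|y' - y| ^+ 2.
Proof.
move=> [df cdf].
have /choice[L HL] : forall j : 'I_n, exists L, 0 <= L /\
    forall y y', `|y - y0| <= r -> `|y' - y0| <= r ->
    `|'D_(delta_mx 0 j) f y' - 'D_(delta_mx 0 j) f y| <= L * `|y' - y|.
  by move=> j; have [L] := C1_lipschitz_cball (cdf (delta_mx 0 j)); exists L.
exists (\sum_j L j); first by apply: sumr_ge0 => j _; have [] := HL j.
move=> y y' yr y'r; set h := y' - y.
have y'E : y + h = y' by rewrite /h addrC subrK.
have dfy : differentiable f y by exact/df/BU.
have srP (s : R) : 0 <= s <= 1 -> `|y + s *: h - y0| <= r.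
  by move=> s01; apply: cball_segment => //; rewrite y'E.
(* With the linear term subtracted, the speed of the curve is a difference of differentials; the
   Lipschitz bounds on the partial derivatives give one factor [|h|] and the differential itself the
   other. *)
have := @curve_mean_value _ (fun s : R => f (y + s *: h) - s *: 'd f y h)
  (fun s : R => 'd f (y + s *: h) h - 'd f y h).
rewrite !scale1r !scale0r subr0 addr0 y'E -(addrAC (f y')).
apply => s s01; have sr := srP s s01;
    have dfs : differentiable f (y + s *: h) by exact/df/BU.
- apply: is_deriveB; first exact: is_derive_line.
  apply: derive1_approx_at => e e0; exists 1 => // s' _.
  by rewrite -scalerBl subrr normr0 mulr_ge0// ltW.
- have : `|y + s *: h - y| <= `|h|.
    move/andP: s01 => [s0 s1].
    by rewrite addrC addKr normrZ ger0_norm// ler_piMl.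
  move: (y + s *: h) sr dfs => z zr dfz zy.
  apply: (le_trans (norm_diffB_le dfy dfz erefl erefl)).
  rewrite expr2 mulrA ler_wpM2r// mulr_suml; apply: ler_sum => j _.
  have [L0 /(_ y z yr zr) H] := HL j.
  by apply: (le_trans H); apply: ler_wpM2l.
Qed.

End Ball.
End RowVectorCalculus.

(** * Tangent vectors in charts *)

Section TangentSpace.
Context {R : realType} {n : nat} {M : topologicalType}.
Variable A : smooth_manifold R n M.
Implicit Types (p : M) (c d e : chart A).

Lemma transition_differentiable c d p : dom c p -> dom d p ->
  differentiable (coord d \o param c) (coord c p).
Proof.
by move=> cp dp; have [df _] := transition_smooth c d 1; apply: df; exists p.
Qed.

Lemma near_param_dom c p (O : set M) : dom c p -> open O -> O p ->
  \forall y \near coord c p, O (param c y).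
Proof.
move=> cp oO Op.
have cpar : {for coord c p, continuous (param c)}.
  by apply: param_continuous; exists p.
by apply: cpar; rewrite coordK//; exact: open_nbhs_nbhs.
Qed.

(** Two transition maps compose to the third only near the point, hence a chain rule up to local
    equality. The point [y'] is separate because [coord d p] agrees with its image under the
    transition map only through [coordK]. *)
Lemma near_diff_comp (V W Z : normedModType R) (f : V -> W) (g : W -> Z)
    (h : V -> Z) (y : V) (y' : W) (w : V) :
  y' = f y -> differentiable f y -> differentiable g y' -> differentiable h y ->
  (\forall x \near y, h x = g (f x)) -> 'd h y w = 'd g y' ('d f y w).
Proof.
move=> -> df dg dh hE.
have e1 : 'D_w h y = 'd h y w := deriveE _ dh.
have dgf : differentiable (g \o f) y := differentiable_comp df dg.
have e2 : 'D_w (g \o f) y = 'd (g \o f) y w := deriveE _ dgf.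
have e3 : 'D_w h y = 'D_w (g \o f) y by exact: near_eq_derive.
have e4 := congr1 (fun F => F w) (diff_comp df dg).
exact: (etrans (esym e1) (etrans e3 (etrans e2 e4))).
Qed.

Lemma diff_transition_comp c d e p w : dom c p -> dom d p -> dom e p ->
  'd (coord e \o param d) (coord d p) ('d (coord d \o param c) (coord c p) w) =
  'd (coord e \o param c) (coord c p) w.
Proof.
move=> cp dp ep.
apply: esym; apply: near_diff_comp; try exact: transition_differentiable.
- by rewrite /= coordK.
- have := near_param_dom cp (dom_open d) dp; apply: filterS => y yd /=.
  by rewrite coordK.
Qed.

Lemma tangent_of_coord_dom c d p w : dom d p ->
  tangent_of_coord c p w d = 'd (coord d \o param c) (coord c p) w.
Proof. by move=> dp; rewrite /tangent_of_coord asboolT. Qed.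

Lemma tangent_of_coord_in c p w : dom c p -> tangent_space p (tangent_of_coord c p w).
Proof.
move=> cp; split=> [d dp|d e dp ep].
  by rewrite /tangent_of_coord asboolF.
exact: etrans (tangent_of_coord_dom c w ep)
  (etrans (esym (diff_transition_comp w cp dp ep))
     (congr1 ('d (coord e \o param d) (coord d p)) (esym (tangent_of_coord_dom c w dp)))).
Qed.

Lemma tangent_of_coordE c p v : dom c p -> tangent_space p v ->
  tangent_of_coord c p (v c) = v.
Proof.
move=> cp [v0 vt]; apply/funext => d; rewrite /tangent_of_coord.
case: asboolP => dp; last by rewrite v0.
exact/esym/vt.
Qed.

Lemma tangent_of_coord_transition c d p w : dom c p -> dom d p ->
  tangent_of_coord d p ('d (coord d \o param c) (coord c p) w) =
  tangent_of_coord c p w.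
Proof.
move=> cp dp; have := tangent_of_coordE dp (tangent_of_coord_in w cp).
exact: (etrans (congr1 (tangent_of_coord d p) (esym (tangent_of_coord_dom c w dp)))).
Qed.

Lemma tangent_of_coord_linear c p k w w' :
  tangent_of_coord c p (k *: w + w') =
  k *: tangent_of_coord c p w + tangent_of_coord c p w'.
Proof.
apply/funext => d.
rewrite -[RHS]/(k *: tangent_of_coord c p w d + tangent_of_coord c p w' d).
rewrite /tangent_of_coord; case: asboolP => _; first exact: linearP.
by rewrite scaler0 addr0.
Qed.

Section Covector.
Variables (p : M) (z : (chart A -> 'rV[R]_n) -> R) (c : chart A).
Hypothesis zp : cotangent_space p z.
Hypothesis cp : dom c p.

Let zc w := z (tangent_of_coord c p w).

Lemma covector_linear k w w' : zc (k *: w + w') = k * zc w + zc w'.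
Proof.
by rewrite /zc tangent_of_coord_linear zp//; exact: tangent_of_coord_in.
Qed.

Lemma covector0 : zc 0 = 0.
Proof. by have := covector_linear (-1) 0 0; rewrite scaler0 addr0 => ->; ring. Qed.

Lemma covector_coord w :
  zc w = \sum_j zc (delta_mx 0 j) * w 0 j.
Proof.
have zcD a b : zc (a + b) = zc a + zc b.
  by have := covector_linear 1 a b; rewrite scale1r mul1r.
rewrite {1}(row_sum_delta w) (big_morph zc zcD covector0).
apply: eq_bigr => j _.
by have := covector_linear (w 0 j) (delta_mx 0 j) 0; rewrite !addr0 covector0 addr0 mulrC.
Qed.

Lemma covector_bound : exists2 K, 0 <= K & forall w, `|zc w| <= K * `|w|.
Proof.
exists (\sum_j `|zc (delta_mx 0 j)|); first exact: sumr_ge0.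
move=> w; rewrite covector_coord (le_trans (ler_norm_sum _ _ _))// mulr_suml.
by apply: ler_sum => j _; rewrite normrM ler_wpM2l// coord_le_norm.
Qed.

End Covector.
End TangentSpace.

(** * Perturbation of a trajectory in a chart *)

Section PerturbationEstimates.
Context {R : realType}.

Lemma abs_continuous_id (a b : R) : abs_continuous a b (fun t : R => t).
Proof.
move=> e e0; exists e => // m x y xy _; rewrite (eq_bigr (fun i => `|y i - x i|))// => i _.
by have [_ [xyi _]] := xy i; rewrite ger0_norm// subr_ge0.
Qed.

(** The majorants of the perturbation estimates have the form [c1 * W + c2 * t]: a drift part run by
    the clock [W], and a part uniform in time due to the bounded variation [v]. *)
Lemma is_derive_affine (f : R -> R) (d c1 c2 t : R) : is_derive t 1 f d ->
  is_derive t 1 (fun s => c1 * f s + c2 * s) (c1 * d + c2).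
Proof.
move=> /is_derive1_approx df; apply: derive1_approx_at => e e0.
have c10 : 0 < `|c1| + 1 by rewrite ltr_wpDl.
have [r r0 H] := df _ (divr_gt0 e0 c10); exists r => // s /H {}H.
rewrite -[_ *: _]/(_ * _) in H *.
have -> : c1 * f s + c2 * s - (c1 * f t + c2 * t) - (s - t) * (c1 * d + c2) =
  c1 * (f s - f t - (s - t) * d) by ring.
rewrite normrM; apply: (@le_trans _ _ ((`|c1| + 1) * (e / (`|c1| + 1) * `|s - t|))).
  by apply: ler_pM => //; rewrite lerDl.
by rewrite mulrA mulrCA divff ?gt_eqF// mulr1.
Qed.

Lemma abs_continuous_linear (V V' W : normedModType R) (a b c d : R)
    (f : R -> V) (g : R -> V') (h : R -> W) :
  0 <= c -> 0 <= d ->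
  (forall x y, a <= x -> x <= y -> y <= b ->
     `|h y - h x| <= c * `|f y - f x| + d * `|g y - g x|) ->
  abs_continuous a b f -> abs_continuous a b g -> abs_continuous a b h.
Proof.
move=> c0 d0 H; apply: (@abs_continuous_dom _ _ _ _ _ _ (c + d)); first exact: addr_ge0.
move=> x y ax xy yb; apply: (le_trans (H x y ax xy yb)).
rewrite mulrDr; apply: lerD; apply: ler_wpM2r => //.
  by rewrite lerDl.
by rewrite lerDr.
Qed.

Lemma abs_continuousM (a b : R) (f g : R -> R) : abs_continuous a b f ->
  abs_continuous a b g -> abs_continuous a b (fun t => f t * g t).
Proof.
move=> acf acg; have [Cf Cf0 Hf] := abs_continuous_bounded acf.
have [Cg Cg0 Hg] := abs_continuous_bounded acg.
apply: (@abs_continuous_linear _ _ _ _ _ Cg Cf f g) => // s t as_ st tb.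
have -> : f t * g t - f s * g s = g t * (f t - f s) + f s * (g t - g s) by ring.
apply: (le_trans (ler_normD _ _)); rewrite !normrM; apply: lerD; apply: ler_wpM2r => //.
  by apply: Hg; rewrite (le_trans as_).
by apply: Hf; rewrite as_ (le_trans st).
Qed.

Lemma abs_continuous_sum (V : normedModType R) (a b : R) m (f : 'I_m -> R -> V) :
  (forall i, abs_continuous a b (f i)) -> abs_continuous a b (fun t => \sum_i f i t).
Proof.
move=> acf; elim: (index_enum _) => [|j s IH].
  have ac_id := @abs_continuous_id a b.
  apply: (@abs_continuous_linear _ _ _ _ _ 0 0 _ _ _ (lexx _) (lexx _) _ ac_id ac_id).
  move=> s t _ _ _.
  by rewrite !big_nil subrr normr0 !mul0r addr0.
apply: (@abs_continuous_linear _ _ _ _ _ 1 1 _ _ _ _ _ _ (acf j) IH) => // p q _ _ _.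
rewrite !big_cons !mul1r opprD addrACA; exact: ler_normD.
Qed.

Lemma ae_forall_ord m (S : 'I_m -> R -> Prop) :
  (forall j, {ae (@lebesgue_measure R), forall t, S j t}) ->
  {ae (@lebesgue_measure R), forall t, forall j, S j t}.
Proof.
elim: m S => [|m IH] S HS.
  by apply/nearW => t [].
apply: ae_sub (ae_and (HS ord0) (IH (fun j => S (lift ord0 j)) (fun j => HS _))) _.
by move=> t [S0 SS] j; case: (unliftP ord0 j) => [j' ->|->].
Qed.

Variables (n l : nat) (F : 'I_l -> 'rV[R]_n -> 'rV[R]_n).
Variable DF : 'I_l -> 'rV[R]_n -> 'rV[R]_n -> 'rV[R]_n.
Variables (y0 : 'rV[R]_n) (r L B C : R).
Hypotheses (L0 : 0 <= L) (B0 : 0 <= B) (C0 : 0 <= C).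
Hypothesis F_lipschitz : forall i y y', `|y - y0| <= r -> `|y' - y0| <= r ->
  `|F i y' - F i y| <= L * `|y' - y|.
Hypothesis F_bounded : forall i y, `|y - y0| <= r -> `|F i y| <= B.
Hypothesis F_taylor : forall i y y', `|y - y0| <= r -> `|y' - y0| <= r ->
  `|F i y' - F i y - DF i y (y' - y)| <= C * `|y' - y| ^+ 2.
Hypothesis DF_coord : forall i y h, `|y - y0| <= r ->
  DF i y h = \sum_j h 0 j *: DF i y (delta_mx 0 j).

Variables (a b e k K : R) (u v : 'I_l -> R -> R) (x xe : R -> 'rV[R]_n) (W : R -> R).
Hypotheses (ab : a <= b) (e0 : 0 <= e) (k0 : 0 <= k) (K0 : 0 <= K).
Hypothesis v_bounded : forall i t, a <= t <= b -> `|v i t| <= K.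
Hypothesis x_ball : forall t, a <= t <= b -> `|x t - y0| <= r.
Hypothesis xe_ball : forall t, a <= t <= b -> `|xe t - y0| <= r.
Hypothesis xe_close : forall t, a <= t <= b -> `|xe t - x t| <= k.
Hypothesis x_ac : abs_continuous a b x.
Hypothesis xe_ac : abs_continuous a b xe.
Hypothesis W_ac : abs_continuous a b W.
Hypothesis x_derive : {ae (@lebesgue_measure R), forall t, a <= t <= b ->
  is_derive t 1 x (\sum_i u i t *: F i (x t))}.
Hypothesis xe_derive : {ae (@lebesgue_measure R), forall t, a <= t <= b ->
  is_derive t 1 xe (\sum_i (u i t + e * v i t) *: F i (xe t))}.
Hypothesis W_derive : {ae (@lebesgue_measure R), forall t, a <= t <= b ->
  is_derive t 1 W (\sum_i `|u i t|)}.

Lemma diff_coord_ac j : abs_continuous a b (fun t => xe t 0 j - x t 0 j).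
Proof.
apply: (@abs_continuous_linear _ _ _ _ _ 1 1 xe x) => //.
move=> s t _ _ _; rewrite !mul1r.
have -> : xe t 0 j - x t 0 j - (xe s 0 j - x s 0 j) =
    (xe t - xe s) 0 j - (x t - x s) 0 j by rewrite !mxE; ring.
by apply: (le_trans (ler_normB _ _)); apply: lerD; exact: coord_le_norm.
Qed.

Lemma diff_coord_derive : {ae (@lebesgue_measure R), forall t, a <= t <= b ->
  forall j, is_derive t 1 (fun t => xe t 0 j - x t 0 j)
    (\sum_i (u i t * (F i (xe t) 0 j - F i (x t) 0 j) + e * v i t * F i (xe t) 0 j))}.
Proof.
apply: ae_sub (ae_and x_derive xe_derive) _ => t [Hx Hxe] tab j.
have dx := is_derive_coord j (Hx tab); have dxe := is_derive_coord j (Hxe tab).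
have -> : \sum_i (u i t * (F i (xe t) 0 j - F i (x t) 0 j) + e * v i t * F i (xe t) 0 j) =
    (\sum_i (u i t + e * v i t) *: F i (xe t)) 0 j - (\sum_i u i t *: F i (x t)) 0 j.
  rewrite !summxE -sumrB; apply: eq_bigr => i _; rewrite !mxE; ring.
exact: is_deriveB.
Qed.

(** The drift [F i (xe t) - F i (x t)] is at most [L * k] and is weighted by |u_i|, hence the
    increment of [W]; the variation contributes at most [e * K * B] for each [i]. The a priori bound
    [k] stays on the right-hand side, to be absorbed later on intervals where [L] times the
    increment of [W] is small. *)
Lemma perturbation_bound :
  `|xe b - x b| <= `|xe a - x a| + L * k * (W b - W a) + e * (l%:R * K * B) * (b - a).
Proof.
have c10 : 0 <= L * k by exact: mulr_ge0.
have c20 : 0 <= e * (l%:R * K * B) by rewrite !mulr_ge0.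
have H j : `|xe b 0 j - x b 0 j - (xe a 0 j - x a 0 j)| <=
    (L * k * W b + e * (l%:R * K * B) * b) - (L * k * W a + e * (l%:R * K * B) * a).
  apply: (@abs_continuous_le _ a b (fun t => xe t 0 j - x t 0 j)
    (fun t => L * k * W t + e * (l%:R * K * B) * t)) => //; first exact: diff_coord_ac.
    apply: (@abs_continuous_linear _ _ _ _ _ (L * k) (e * (l%:R * K * B)) W (fun t => t)) => //.
      move=> s t _ _ _; rewrite opprD addrACA -!mulrBr.
      rewrite (le_trans (ler_normD _ _))// (normrM (L * k)) (normrM (e * _)).
      by rewrite (ger0_norm c10) (ger0_norm c20).
    exact: abs_continuous_id.
  apply: ae_sub (ae_and diff_coord_derive W_derive) _ => t [Hd HW] tab.
  eexists; exists (L * k * (\sum_i `|u i t|) + e * (l%:R * K * B)).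
  split; first exact: Hd.
    exact: is_derive_affine (HW tab).
  have -> : L * k * (\sum_i `|u i t|) + e * (l%:R * K * B) =
      \sum_(i < l) (`|u i t| * (L * k) + e * K * B).
    rewrite big_split/= sumr_const card_ord -mulr_suml -[(_ * _ * B) *+ l]mulr_natr.
    ring.
  apply: (le_trans (ler_norm_sum _ _ _)); apply: ler_sum => i _.
  apply: (le_trans (ler_normD _ _)); rewrite !normrM; apply: lerD.
    apply: ler_wpM2l => //.
    have -> : F i (xe t) 0 j - F i (x t) 0 j = (F i (xe t) - F i (x t)) 0 j by rewrite !mxE.
    apply: (le_trans (coord_le_norm _ _)).
    apply: (le_trans (F_lipschitz _ (x_ball tab) (xe_ball tab))).
    by apply: ler_wpM2l => //; exact: xe_close.
  rewrite (ger0_norm e0) -!mulrA; apply: ler_wpM2l => //; apply: ler_pM => //.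
    exact: v_bounded.
  by apply: (le_trans (coord_le_norm _ _)); apply/F_bounded/xe_ball.
have W_nd : W a <= W b.
  apply: (abs_continuous_nondecreasing W_ac) => //.
  apply: ae_sub W_derive _ => t HW tab; exists (\sum_i `|u i t|); last exact: HW.
  exact: sumr_ge0.
apply: norm_le_coord.
  by rewrite !addr_ge0// mulr_ge0// subr_ge0.
move=> j; rewrite !mxE; have := H j.
have := coord_le_norm (xe a - x a) j; rewrite !mxE.
move: (xe b 0 j - x b 0 j) (xe a 0 j - x a 0 j) => p q.
rewrite !ler_norml => /andP[h1 h2] /andP[h3 h4].
by apply/andP; split; lra.
Qed.

Variables (P : 'I_n -> R -> R) (Q : R) (J : R -> R).
Hypotheses (Q0 : 0 <= Q).
Hypothesis P_bounded : forall j t, a <= t <= b -> `|P j t| <= Q.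
Hypothesis P_ac : forall j, abs_continuous a b (P j).
Hypothesis J_ac : abs_continuous a b J.
Let pair (t : R) (w : 'rV[R]_n) : R := \sum_j P j t * w 0 j.
Hypothesis P_derive : forall j, {ae (@lebesgue_measure R), forall t, a <= t <= b ->
  is_derive t 1 (P j) (- \sum_i u i t * pair t (DF i (x t) (delta_mx 0 j)))}.
Hypothesis J_derive : {ae (@lebesgue_measure R), forall t, a <= t <= b ->
  is_derive t 1 J (\sum_i v i t ^+ 2)}.
Hypothesis vE : forall i t, a <= t <= b -> v i t = pair t (F i (x t)).

Let pair_bound t w : a <= t <= b -> `|pair t w| <= n%:R * Q * `|w|.
Proof.
move=> tab; apply: (le_trans (ler_norm_sum _ _ _)).
have -> : n%:R * Q * `|w| = \sum_(j < n) Q * `|w|.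
  by rewrite sumr_const card_ord -[RHS]mulr_natl mulrA.
apply: ler_sum => j _; rewrite normrM; apply: ler_pM => //; first exact: P_bounded.
exact: coord_le_norm.
Qed.

(* The terms linear in xe - x cancel between the derivatives of P and of xe - x. *)
Lemma pairing_derive : {ae (@lebesgue_measure R), forall t, a <= t <= b ->
  is_derive t 1 (fun t => pair t (xe t - x t) - e * J t)
    (\sum_i (u i t * pair t (F i (xe t) - F i (x t) - DF i (x t) (xe t - x t)) +
             e * v i t * pair t (F i (xe t) - F i (x t))))}.
Proof.
have := ae_and (ae_and diff_coord_derive (ae_forall_ord P_derive)) J_derive.
move=> /ae_sub; apply => t [[Hd HP] HJ] tab.
have E : (fun t => pair t (xe t - x t)) =
    (\sum_(j < n) (P j * (fun t => xe t 0 j - x t 0 j)))%R.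
  apply/funext => s; rewrite fct_sumE; apply: eq_bigr => j _.
  by rewrite -[RHS]/(P j s * (xe s 0 j - x s 0 j)) !mxE.
have D1 : is_derive t 1 (fun t => pair t (xe t - x t))
    (\sum_(j < n) (P j t *: (\sum_i (u i t * (F i (xe t) 0 j - F i (x t) 0 j) +
                                      e * v i t * F i (xe t) 0 j)) +
      (xe t 0 j - x t 0 j) *: (- \sum_i u i t * pair t (DF i (x t) (delta_mx 0 j))))).
  rewrite E; apply: is_derive_sum => j; apply: is_deriveM; [exact: HP|exact: Hd].
have D2 : is_derive t 1 (fun t => e * J t) (e * \sum_i v i t ^+ 2).
  exact: (@is_deriveZ _ _ _ J e _ _ _ (HJ tab)).
apply: is_derive_eq (is_deriveB D1 D2) _.
have DFE i : pair t (DF i (x t) (xe t - x t)) =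
    \sum_j (xe t 0 j - x t 0 j) * pair t (DF i (x t) (delta_mx 0 j)).
  rewrite /pair DF_coord; last exact: x_ball.
  under eq_bigr do rewrite summxE mulr_sumr.
  rewrite exchange_big/=; apply: eq_bigr => j _; rewrite mulr_sumr.
  by apply: eq_bigr => j' _; rewrite !mxE; ring.
have pairB w w' : pair t (w - w') = pair t w - pair t w'.
  by rewrite /pair -sumrB; apply: eq_bigr => j _; rewrite !mxE mulrBr.
transitivity (\sum_i (u i t * (pair t (F i (xe t)) - pair t (F i (x t)) -
    pair t (DF i (x t) (xe t - x t))) + e * v i t * pair t (F i (xe t))) - e * \sum_i v i t ^+ 2).
  congr (_ - _); under eq_bigr do rewrite /= scalerN -[_ *: _]/(_ * _) -[_ *: _]/(_ * _).
  rewrite sumrB.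
  under eq_bigr do rewrite mulr_sumr.
  under [X in _ - X]eq_bigr do rewrite mulr_sumr.
  rewrite exchange_big/= [X in _ - X]exchange_big/= -sumrB; apply: eq_bigr => i _.
  have pairE w : pair t w = \sum_j P j t * w 0 j by [].
  rewrite DFE (pairE (F i (xe t))) (pairE (F i (x t))) -!sumrB !mulr_sumr -big_split/=.
  by apply: eq_bigr => j _; ring.
(* One factor of each [v i t ^+ 2] is read as [pair t (F i (x t))], which leaves [v i t] times a
   pairing with [F i (xe t) - F i (x t)]. *)
rewrite mulr_sumr -sumrB; apply: eq_bigr => i _.
by rewrite !pairB [in v i t ^+ 2](vE i tab) ?(vE i tab); ring.
Qed.

(** The Taylor remainder costs [C * k ^+ 2] against |u_i|, the variation costs [e * K] times a
    Lipschitz difference [L * k]. For [k] of order [e] both are of order [e ^+ 2]. *)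
Lemma pairing_estimate :
  `|pair b (xe b - x b) - pair a (xe a - x a) - e * (J b - J a)| <=
  n%:R * Q * C * k ^+ 2 * (W b - W a) + e * (l%:R * K * (n%:R * Q) * L * k) * (b - a).
Proof.
have c10 : 0 <= n%:R * Q * C * k ^+ 2 by rewrite !mulr_ge0// exprn_ge0.
have c20 : 0 <= e * (l%:R * K * (n%:R * Q) * L * k) by rewrite !mulr_ge0.
have -> : pair b (xe b - x b) - pair a (xe a - x a) - e * (J b - J a) =
  (pair b (xe b - x b) - e * J b) - (pair a (xe a - x a) - e * J a) by ring.
have -> : n%:R * Q * C * k ^+ 2 * (W b - W a) + e * (l%:R * K * (n%:R * Q) * L * k) * (b - a) =
  (n%:R * Q * C * k ^+ 2 * W b + e * (l%:R * K * (n%:R * Q) * L * k) * b) -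
  (n%:R * Q * C * k ^+ 2 * W a + e * (l%:R * K * (n%:R * Q) * L * k) * a) by ring.
set c1 := _ * k ^+ 2 in c10 *; set c2 := e * (_ * k) in c20 *.
apply: (@abs_continuous_le _ a b (fun t => pair t (xe t - x t) - e * J t)
    (fun t => c1 * W t + c2 * t)) => //.
- have pair_ac : abs_continuous a b (fun t => pair t (xe t - x t)).
    have -> : (fun t => pair t (xe t - x t)) =
        (fun t => \sum_j P j t * (xe t 0 j - x t 0 j)).
      by apply/funext => t; apply: eq_bigr => j _; rewrite !mxE.
    by apply: abs_continuous_sum => j; apply: abs_continuousM => //; exact: diff_coord_ac.
  apply: (@abs_continuous_linear _ _ _ _ _ 1 e _ J _ _ e0 _ pair_ac J_ac) => // s t _ _ _.
  have -> : pair t (xe t - x t) - e * J t - (pair s (xe s - x s) - e * J s) =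
    (pair t (xe t - x t) - pair s (xe s - x s)) - e * (J t - J s) by ring.
  by rewrite mul1r (le_trans (ler_normB _ _))// normrM (ger0_norm e0).
- apply: (@abs_continuous_linear _ _ _ _ _ c1 c2 W (fun t => t)) => //.
    move=> s t _ _ _; rewrite opprD addrACA -!mulrBr.
    by rewrite (le_trans (ler_normD _ _))// (normrM c1) (normrM c2) (ger0_norm c10) (ger0_norm c20).
  exact: abs_continuous_id.
apply: ae_sub (ae_and pairing_derive W_derive) _ => t [Hd HW] tab.
eexists; exists (c1 * (\sum_i `|u i t|) + c2).
split; first exact: Hd.
  exact: is_derive_affine (HW tab).
have -> : c1 * (\sum_i `|u i t|) + c2 =
    \sum_(i < l) (`|u i t| * c1 + e * K * (n%:R * Q * (L * k))).
  rewrite big_split/= sumr_const card_ord -mulr_suml -[(_ * (_ * (L * k))) *+ l]mulr_natr /c2.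
  ring.
apply: (le_trans (ler_norm_sum _ _ _)); apply: ler_sum => i _.
have nQ : 0 <= n%:R * Q by rewrite mulr_ge0.
apply: (le_trans (ler_normD _ _)); rewrite !normrM; apply: lerD.
  apply: ler_wpM2l => //; apply: (le_trans (pair_bound _ tab)).
  rewrite /c1 -!(mulrA (n%:R * Q)); apply: ler_wpM2l => //.
  apply: (le_trans (F_taylor _ (x_ball tab) (xe_ball tab))).
  by apply: ler_wpM2l => //; rewrite lerXn2r ?nnegrE// xe_close.
rewrite (ger0_norm e0) -!(mulrA e); apply: ler_wpM2l => //; apply: ler_pM => //.
  exact: v_bounded.
apply: (le_trans (pair_bound _ tab)); apply: ler_wpM2l => //.
apply: (le_trans (F_lipschitz _ (x_ball tab) (xe_ball tab))).
by apply: ler_wpM2l => //; exact: xe_close.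
Qed.

End PerturbationEstimates.

(** * First-order expansion along the trajectory *)

Section FirstOrderApproximation.
Context {R : realType}.

Lemma diff_approx (V W : normedModType R) (f : V -> W) (y : V) :
  differentiable f y -> forall e : R, 0 < e -> exists2 r, 0 < r &
    forall h, `|h| < r -> `|f (y + h) - f y - 'd f y h| <= e * `|h|.
Proof.
move=> /diff_locally /eqaddoP H e e0.
have /nbhs_ballP[r /= r0 Hr] := H e e0.
exists r => // h hr; have /Hr : ball 0 r h.
  by rewrite -ball_normE /ball_/= sub0r normrN.
rewrite (addrC y).
by rewrite -[X in `|X|]/(f (h + y) - (f y + 'd f y h)) opprD addrA.
Qed.

Lemma norm_diff_le n m (f : 'rV[R]_n -> 'rV[R]_m) y h : differentiable f y ->
  `|'d f y h| <= (\sum_j `|'D_(delta_mx 0 j) f y|) * `|h|.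
Proof.
move=> df; rewrite (diff_row_sum h df) mulr_suml.
apply: (le_trans (ler_norm_sum _ _ _)); apply: ler_sum => j _.
by rewrite normrZ mulrC ler_wpM2l// coord_le_norm.
Qed.

Lemma within_continuous_nbhs (M : topologicalType) (a b t : R) (q : R -> M) (O : set M) :
  {within `[a, b], continuous q} -> a <= t <= b -> nbhs (q t) O ->
  exists2 d, 0 < d & forall s, a <= s <= b -> `|s - t| < d -> O (q s).
Proof.
move=> /subspace_continuousP cq tab Ot.
have /cq : `[a, b]%classic t by rewrite /= in_itv.
move=> /(_ O Ot) /nbhs_ballP[d /= d0 H].
exists d => // s sab st; apply: H => /=; last by rewrite in_itv.
by rewrite /ball/= distrC.
Qed.

Context {n l : nat} {M : topologicalType}.
Variables (A : smooth_manifold R n M).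
Variables (T : R) (q : R -> M) (z : R -> (chart A -> 'rV[R]_n) -> R).
Variables (J : R -> R) (qe : R -> R -> M).

(* qe e is the trajectory of the control u + e v, z is a covector along q and
   J is the integral of the squares of the components of v. *)
Definition first_order (c : chart A) (t : R) : Prop := exists C e1 : R,
  [/\ 0 <= C, 0 < e1,
      forall e, 0 < e < e1 -> dom c (qe e t) /\
        `|coord c (qe e t) - coord c (q t)| <= C * e &
      forall eta, 0 < eta -> exists2 e2, 0 < e2 & forall e, 0 < e < e2 ->
        `|z t (tangent_of_coord c (q t) (coord c (qe e t) - coord c (q t))) -
          e * J t| <= eta * e].

(** A transition map differs from its differential by o(|h|), which is o(e) thanks to the bound
    [C * e] on the displacement; the differential itself only renames the same tangent vector. *)
Lemma first_order_transition c d t : cotangent_space (q t) (z t) ->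
  dom c (q t) -> dom d (q t) -> first_order c t -> first_order d t.
Proof.
move=> zt cq dq [C [e1 [C0 e10 close asym]]].
pose y := coord c (q t); pose G := coord d \o param c.
have dG : differentiable G y by exact: transition_differentiable.
have Gy : G y = coord d (q t) by rewrite /G /y /= coordK.
pose Kd := \sum_j `|'D_(delta_mx 0 j) G y|.
have Kd0 : 0 <= Kd by exact: sumr_ge0.
have [Kz Kz0 HKz] := covector_bound zt dq.
have /nbhs_ballP[r2 /= r20 Hr2] := near_param_dom cq (dom_open d) dq.
have yball h : `|h| < r2 -> dom d (param c (y + h)).
  move=> hr; apply: Hr2; rewrite -ball_normE /ball_/= -/y.
  by rewrite opprD addrA subrr sub0r normrN.
have C1 : 0 < C + 1 by rewrite ltr_wpDl.
have main e h : 0 < e < e1 -> coord c (qe e t) - y = h -> qe e t = param c (y + h) /\ `|h| <= C * e.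
  move=> /close[cqe le] <-; split; last exact: le.
  by rewrite addrC subrK coordK.
have [r1 r10 Hr1] := diff_approx dG ltr01.
have small r e : 0 < r -> 0 < e < r / (C + 1) -> C * e < r.
  move=> r0 /andP[e0]; rewrite ltr_pdivlMr//; apply: le_lt_trans.
  by rewrite mulrC ler_wpM2l ?(ltW e0)// lerDl.
have coordd e : 0 < e < Num.min e1 (r2 / (C + 1)) ->
    let h := coord c (qe e t) - y in
    [/\ dom d (qe e t), coord d (qe e t) - coord d (q t) = G (y + h) - G y & `|h| <= C * e].
  rewrite lt_min => /and3P[e0 ee1 er2] h.
  have [|qeE hC] := main e h _ erefl; first by rewrite e0.
  rewrite Gy /G /= -qeE; split => //.
  rewrite qeE; apply: yball; apply: (le_lt_trans hC); apply: small => //.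
  by rewrite e0.
exists ((1 + Kd) * C), (Num.min (Num.min e1 (r2 / (C + 1))) (r1 / (C + 1))); split.
- by rewrite mulr_ge0// addr_ge0.
- by rewrite !lt_min e10 !divr_gt0.
- move=> e; rewrite lt_min => /and3P[e0 ee er1].
  have [|ddq -> hC] := coordd e; first by rewrite e0.
  split => //; move: hC; set h := coord c _ - y => hC.
  have hr1 : `|h| < r1 by apply: (le_lt_trans hC); apply: small => //; rewrite e0.
  have := Hr1 _ hr1; have := norm_diff_le h dG; rewrite -/Kd => H1 H2.
  rewrite -[G (y + h) - G y](subrK ('d G y h)).
  apply: (le_trans (ler_normD _ _)); apply: (le_trans (lerD H2 H1)).
  by rewrite -mulrDl -mulrA ler_wpM2l// addr_ge0.
move=> eta eta0.
(* Half of [eta] pays for the nonlinear rest of the transition map, of size [eta' * (C * e)] before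
   [Kz] is applied; the other half pays for the expansion in the chart [c]. *)
pose eta' := eta / (2 * (Kz * C + 1)).
have KC : 0 < Kz * C + 1 by rewrite ltr_wpDl// mulr_ge0.
have eta'0 : 0 < eta' by rewrite divr_gt0// mulr_gt0.
have [r3 r30 Hr3] := diff_approx dG eta'0.
have [|e2 e20 He2] := asym (eta / 2); first by rewrite divr_gt0.
exists (Num.min (Num.min e1 (r2 / (C + 1))) (Num.min (r3 / (C + 1)) e2)).
  by rewrite !lt_min e10 e20 !divr_gt0.
move=> e /andP[e0]; rewrite lt_min => /andP[ee]; rewrite lt_min => /andP[er3 ee2].
have [|ddq -> hC] := coordd e; first by rewrite e0.
have := He2 e; rewrite -/y e0 ee2 => /(_ isT).
move: hC; set h := coord c _ - y => hC asymE.
have hr3 : `|h| < r3 by apply: (le_lt_trans hC); apply: small => //; rewrite e0.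
have := Hr3 _ hr3; set rest := G (y + h) - G y - 'd G y h => restE.
have zrest : `|z t (tangent_of_coord d (q t) rest)| <= eta / 2 * e.
  apply: (le_trans (HKz rest)).
  apply: (@le_trans _ _ (Kz * (eta' * (C * e)))).
    apply: ler_wpM2l => //; apply: (le_trans restE); apply: ler_wpM2l => //.
    exact: ltW.
  have -> : eta / 2 * e = (Kz * C + 1) * (eta' * e).
    by rewrite /eta'; field; rewrite gt_eqF.
  have -> : Kz * (eta' * (C * e)) = Kz * C * (eta' * e) by ring.
  by apply: ler_wpM2r; [rewrite mulr_ge0// ltW|rewrite lerDl].
have zE : z t (tangent_of_coord d (q t) (G (y + h) - G y)) =
    z t (tangent_of_coord d (q t) rest) + z t (tangent_of_coord c (q t) h).
  have e3 : z t (tangent_of_coord d (q t) ('d G y h)) = z t (tangent_of_coord c (q t) h).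
    have e5 := tangent_of_coord_transition h cq dq.
    exact: (f_equal (z t) e5).
  have e4 : G (y + h) - G y = 1 *: rest + 'd G y h.
    by rewrite scale1r /rest subrK.
  rewrite e4 covector_linear// mul1r; congr (_ + _); exact: e3.
rewrite zE -addrA; apply: (le_trans (ler_normD _ _)).
have -> : eta * e = eta / 2 * e + eta / 2 * e by field.
exact: lerD.
Qed.

End FirstOrderApproximation.

(** * The expansion carried through a chart, and then along the whole trajectory *)

Section ChartStep.
Context {R : realType} {n l : nat} {M : topologicalType}.
Variables (A : smooth_manifold R n M) (X : 'I_l -> M -> chart A -> 'rV[R]_n).
Variables (T : R) (q0 : M) (u v : control l T) (q : R -> M).
Variables (z : R -> (chart A -> 'rV[R]_n) -> R) (J W : R -> R) (K : R).
Variables (qe : R -> R -> M) (e0 : R).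
Hypothesis q_traj : trajectory X q0 u q.
Hypothesis z_cov : forall t, 0 <= t <= T -> cotangent_space (q t) (z t).
Hypothesis z_evol : forall c s r, in_chart T q c s r -> forall w,
  abs_continuous s r (fun t => z t (tangent_of_coord c (q t) w)) /\
  {ae (@lebesgue_measure R), forall t, s <= t <= r ->
    is_derive t 1 (fun t => z t (tangent_of_coord c (q t) w))
      (- \sum_i u i t * z t (tangent_of_coord c (q t)
           ('d (fun y => X i (param c y) c) (coord c (q t)) w)))}.
Hypothesis vE : forall i t, 0 <= t <= T -> v i t = z t (X i (q t)).
Hypothesis X_smooth : forall i, smooth_vector_field (X i).
Hypothesis K0 : 0 <= K.
Hypothesis v_bounded : forall i t, 0 <= t <= T -> `|v i t| <= K.
Hypothesis W_ac : abs_continuous 0 T W.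
Hypothesis W_derive : {ae (@lebesgue_measure R), forall t, 0 <= t <= T ->
  is_derive t 1 W (\sum_i `|u i t|)}.
Hypothesis J_ac : abs_continuous 0 T J.
Hypothesis J_derive : {ae (@lebesgue_measure R), forall t, 0 <= t <= T ->
  is_derive t 1 J (\sum_i v i t ^+ 2)}.
Hypothesis e0_gt0 : 0 < e0.
Hypothesis qe_traj : forall e, 0 < e < e0 -> trajectory X q0 (u + e *: v) (qe e).

Lemma W_nondecreasing s t : 0 <= s -> s <= t -> t <= T -> W s <= W t.
Proof.
move=> s0 st tT; apply: abs_continuous_nondecreasing st.
  exact: abs_continuousS W_ac.
apply: ae_sub W_derive _ => x Hx /andP[sx xt]; exists (\sum_i `|u i x|).
  exact: sumr_ge0.
by apply: Hx; rewrite (le_trans s0)//= (le_trans xt).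
Qed.

Section InChart.
Variables (c : chart A) (a b : R) (y0 : 'rV[R]_n) (r L B C : R).
Hypothesis abc : in_chart T q c a b.
Hypothesis r0 : 0 < r.
Hypothesis ball_dom : forall y, `|y - y0| <= r -> (coord c @` dom c) y.
Hypothesis x_ball : forall t, a <= t <= b -> `|coord c (q t) - y0| <= r / 2.
Let F i y := X i (param c y) c.
Hypotheses (L0 : 0 <= L) (B0 : 0 <= B) (C0 : 0 <= C).
Hypothesis F_lipschitz : forall i y y', `|y - y0| <= r -> `|y' - y0| <= r ->
  `|F i y' - F i y| <= L * `|y' - y|.
Hypothesis F_bounded : forall i y, `|y - y0| <= r -> `|F i y| <= B.
Hypothesis F_taylor : forall i y y', `|y - y0| <= r -> `|y' - y0| <= r ->
  `|F i y' - F i y - 'd (F i) y (y' - y)| <= C * `|y' - y| ^+ 2.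
Hypothesis F_diff : forall i y, `|y - y0| <= r -> differentiable (F i) y.
Hypothesis W_small : L * (W b - W a) <= 1 / 2.

Let a0 : 0 <= a. Proof. by case: abc. Qed.
Let ab : a <= b. Proof. by case: abc. Qed.
Let bT : b <= T. Proof. by case: abc. Qed.
Let qc t : a <= t <= b -> dom c (q t). Proof. by case: abc => _ _ _; apply. Qed.
Let tT t : a <= t <= b -> 0 <= t <= T.
Proof. by move=> /andP[at_ tb]; rewrite (le_trans a0)//= (le_trans tb). Qed.

Let ae_restrict (S : R -> Prop) t : t <= b ->
  {ae (@lebesgue_measure R), forall s, 0 <= s <= T -> S s} ->
  {ae (@lebesgue_measure R), forall s, a <= s <= t -> S s}.
Proof.
move=> tb /ae_sub; apply => s H /andP[as_ st]; apply/H/tT.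
by rewrite as_ (le_trans st).
Qed.

(** The end time [t] is free because a perturbed curve is known to lie in the chart only up to the
    time reached by the continuity argument. *)
Lemma chart_solution (w : control l T) (q' : R -> M) t : trajectory X q0 w q' ->
  a <= t <= b -> (forall s, a <= s <= t -> dom c (q' s)) ->
  abs_continuous a t (coord c \o q') /\
  {ae (@lebesgue_measure R), forall s, a <= s <= t ->
    is_derive s 1 (coord c \o q') (\sum_i w i s *: F i (coord c (q' s)))}.
Proof.
move=> [_ _ Hw] /andP[at_ tb] dq'.
have [|ac der] := Hw c a t.
  by split => //; exact: le_trans tb bT.
split => //; apply: ae_sub der _ => s H ast.
rewrite (eq_bigr (fun i => w i s *: X i (q' s) c)); first exact: H.
by move=> i _; rewrite /F coordK//; exact: dq'.
Qed.

Section Tube.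
Variable C0' : R.
Hypothesis C0'0 : 0 <= C0'.

(* If the curves are C0' e apart at a, they stay tube_slope * e apart: over [a, b]
   the drift contributes at most half of that distance by W_small. *)
Definition tube_slope := 2 * (C0' + l%:R * K * B * (b - a)) + 1.

Lemma tube_slope_gt0 : 0 < tube_slope.
Proof.
rewrite ltr_wpDl// mulr_ge0// addr_ge0// !mulr_ge0//.
by rewrite subr_ge0.
Qed.

(** The reference curve keeps to half of the radius; the other half is room for the deviation. *)
Lemma tube_ball e t : e < r / (2 * tube_slope) ->
  a <= t <= b -> `|coord c (qe e t) - coord c (q t)| <= tube_slope * e ->
  `|coord c (qe e t) - y0| <= r.
Proof.
move=> er tab le; have := x_ball tab.
have {}er : e * (2 * tube_slope) < r.
  by rewrite -ltr_pdivlMr// mulr_gt0 ?tube_slope_gt0.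
move=> xb; rewrite -(subrK (coord c (q t)) (coord c (qe e t))) -addrA.
by apply: (le_trans (ler_normD _ _)); apply: (le_trans (lerD le xb)); lra.
Qed.

(** The a priori bound reproduces itself with a gain: [W_small] leaves half of it, the initial gap
    and the variation add half of [tube_slope - 1] times [e], so [e / 2] is left over. The
    strictness drives the continuity argument in [tube]. *)
Lemma tube_bound e t : 0 < e < e0 -> e < r / (2 * tube_slope) ->
  dom c (qe e a) -> `|coord c (qe e a) - coord c (q a)| <= C0' * e ->
  a <= t <= b ->
  (forall s, a <= s <= t -> dom c (qe e s) /\
    `|coord c (qe e s) - coord c (q s)| <= tube_slope * e) ->
  `|coord c (qe e t) - coord c (q t)| < tube_slope * e.
Proof.
move=> ee er da le /andP[at_ tb] H.
have tab : a <= t <= b by rewrite at_.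
have sab s : a <= s <= t -> a <= s <= b by move=> /andP[-> /le_trans->].
have e_gt0 : 0 < e by case/andP: ee.
have [xac xder] := chart_solution q_traj tab (fun s st => qc (sab s st)).
have [xeac xeder] := chart_solution (qe_traj ee) tab (fun s st => (H s st).1).
have S0 := tube_slope_gt0.
have Wt : L * (W t - W a) <= 1 / 2.
  apply: le_trans W_small; apply: ler_wpM2l => //; apply: lerB => //.
  by apply: W_nondecreasing => //; exact: le_trans a0 at_.
have x_r s : a <= s <= t -> `|coord c (q s) - y0| <= r.
  move=> /sab /x_ball /le_trans; apply; rewrite ler_pdivrMr// ler_pMr// ?ler1n//.
have xe_r s : a <= s <= t -> `|coord c (qe e s) - y0| <= r.
  by move=> st; apply: tube_ball er (sab s st) (H s st).2.
have := perturbation_bound L0 B0 F_lipschitz F_bounded at_ (ltW e_gt0)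
  (mulr_ge0 (ltW S0) (ltW e_gt0)) K0 (fun i s st => v_bounded i (tT (sab s st)))
  x_r xe_r (fun s st => (H s st).2) xac xeac
  (abs_continuousS a0 (le_trans tb bT) W_ac) xder xeder (ae_restrict tb W_derive).
move=> /= le2; apply: (le_lt_trans le2).
have h1 : L * (tube_slope * e) * (W t - W a) <= 1 / 2 * (tube_slope * e).
  have -> : L * (tube_slope * e) * (W t - W a) = L * (W t - W a) * (tube_slope * e) by ring.
  by apply: ler_wpM2r => //; rewrite mulr_ge0 ?ltW.
have h2 : e * (l%:R * K * B) * (t - a) <= e * (l%:R * K * B) * (b - a).
  by apply: ler_wpM2l; [rewrite !mulr_ge0// ltW|rewrite lerD2r].
apply: (@le_lt_trans _ _ (C0' * e + 1 / 2 * (tube_slope * e) + e * (l%:R * K * B) * (b - a))).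
  by rewrite !lerD.
rewrite /tube_slope; nra.
Qed.

Lemma near_coord (p : M) eta : dom c p -> 0 < eta ->
  nbhs p [set p' | dom c p' /\ `|coord c p' - coord c p| < eta].
Proof.
move=> cp eta0; apply: filterI; first exact: open_nbhs_nbhs (conj (dom_open c) cp).
have /cvgrPdist_lt/(_ eta eta0) := coord_continuous cp.
by apply: filterS => p'; rewrite distrC.
Qed.

(* This keeps qe in the domain of the chart at the end of an interval. *)
Lemma closed_param_cball : closed (param c @` [set y | `|y - y0| <= r]).
Proof.
apply: compact_closed; first exact: manifold_hausdorff A.
apply: continuous_compact; last exact: compact_cball.
apply: continuous_in_subspaceT => y; rewrite inE/= => /ball_dom.
exact: param_continuous.
Qed.

(** A continuity argument in time: the strict inequality of [tube_bound] leaves slack to go past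
    [t], and continuity of the curves carries the weak inequality to a limit time. *)
Lemma tube e : 0 < e < e0 -> e < r / (2 * tube_slope) ->
  dom c (qe e a) -> `|coord c (qe e a) - coord c (q a)| <= C0' * e ->
  forall t, a <= t <= b -> dom c (qe e t) /\
    `|coord c (qe e t) - coord c (q t)| <= tube_slope * e.
Proof.
move=> ee er da le; have e_gt0 : 0 < e by case/andP: ee.
have [_ cq _] := q_traj; have [_ cqe _] := qe_traj ee.
have near_t t eta : a <= t <= b -> dom c (qe e t) -> 0 < eta ->
    exists2 d, 0 < d & forall s, a <= s <= b -> `|s - t| < d ->
      [/\ dom c (qe e s), `|coord c (qe e s) - coord c (qe e t)| < eta &
         `|coord c (q s) - coord c (q t)| < eta].
  move=> tab dqe eta0.
  have [d1 d10 H1] := within_continuous_nbhs cq (tT tab) (near_coord (qc tab) eta0).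
  have [d2 d20 H2] := within_continuous_nbhs cqe (tT tab) (near_coord dqe eta0).
  exists (Num.min d1 d2); first by rewrite lt_min d10.
  move=> s sab; rewrite lt_min => /andP[s1 s2].
  by have [_ ?] := H1 s (tT sab) s1; have [? ?] := H2 s (tT sab) s2.
pose w t := coord c (qe e t) - coord c (q t).
have wB t s : w s - w t =
    (coord c (qe e s) - coord c (qe e t)) - (coord c (q s) - coord c (q t)).
  by rewrite /w !opprB addrACA [RHS]addrACA; congr (_ + _); exact: addrC.
apply: real_induction.
- split => //; apply: (le_trans le); apply: ler_wpM2r; first exact: ltW.
  have : 0 <= l%:R * K * B * (b - a) by rewrite !mulr_ge0// subr_ge0.
  by move: C0'0; rewrite /tube_slope; lra.
- move=> t /andP[at_ tb] H.
  have tab : a <= t <= b by rewrite at_ ltW.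
  have [dqe _] : dom c (qe e t) /\ `|w t| <= tube_slope * e by apply: H; rewrite at_ lexx.
  have lt_t : `|w t| < tube_slope * e by exact: tube_bound.
  (* Half of the slack for each curve, since both of them move. *)
  pose eta := (tube_slope * e - `|w t|) / 2.
  have eta0 : 0 < eta by rewrite divr_gt0// subr_gt0.
  have [d d0 Hd] := near_t t eta tab dqe eta0.
  exists d => // s /andP[ts sb] std.
  have [||dqs h1 h2] := Hd s.
  + by rewrite (le_trans at_ (ltW ts)).
  + by rewrite ger0_norm ?subr_ge0 ?(ltW ts)//; lra.
  split => //; rewrite -/(w s) -(subrK (w t) (w s)) wB.
  apply: (le_trans (ler_normD _ _)).
  have := ler_normB (coord c (qe e s) - coord c (qe e t)) (coord c (q s) - coord c (q t)).
  by move: h1 h2; rewrite /eta; lra.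
- move=> t /andP[at_ tb] H.
  have tab : a <= t <= b by rewrite tb ltW.
  (* The coordinates of [qe e t] mean nothing before it is known to lie in [dom c]. At earlier times
     the curve is in a closed subset of the domain, so it is there at [t] too. *)
  have [y yr yE] : (param c @` [set y | `|y - y0| <= r]) (qe e t).
    apply: contrapT => nK.
    have nb : nbhs (qe e t) (~` (param c @` [set y | `|y - y0| <= r])).
      by apply: open_nbhs_nbhs; split => //; apply: closed_openC; exact: closed_param_cball.
    have [d d0 Hd] := within_continuous_nbhs cqe (tT tab) nb.
    pose s := Num.max a (t - d / 2).
    have st : s < t by rewrite gt_max at_ /=; lra.
    have as_ : a <= s by rewrite le_max lexx.
    have : t - d / 2 <= s by rewrite le_max lexx orbT.
    move=> sd; have sab : a <= s <= b by rewrite as_ (le_trans (ltW st)).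
    have [|] := Hd s (tT sab); first by rewrite ler0_norm ?subr_le0 ?(ltW st)//; lra.
    have [|dqs ws] := H s; first by rewrite as_.
    exists (coord c (qe e s)); last exact: coordK.
    exact: tube_ball er sab ws.
  have dqe : dom c (qe e t).
    by rewrite -yE; have [p' cp' <-] := ball_dom yr; rewrite coordK.
  split => //; rewrite leNgt; apply/negP; rewrite -/(w t) => lt_t.
  pose eta := (`|w t| - tube_slope * e) / 2.
  have eta0 : 0 < eta by rewrite divr_gt0// subr_gt0.
  have [d d0 Hd] := near_t t eta tab dqe eta0.
  pose s := Num.max a (t - d / 2).
  have st : s < t by rewrite gt_max at_ /=; lra.
  have as_ : a <= s by rewrite le_max lexx.
  have sd : t - d / 2 <= s by rewrite le_max lexx orbT.
  have [||dqs h1 h2] := Hd s.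
  + by rewrite as_ (le_trans (ltW st)).
  + by rewrite ler0_norm ?subr_le0 ?(ltW st)//; lra.
  have [|_] := H s; first by rewrite as_.
  rewrite -/(w s).
  have : `|w t| <= `|w s| + `|w s - w t|.
    by rewrite -{1}(subKr (w s) (w t)) (le_trans (ler_normB _ _)).
  rewrite wB; have := ler_normB (coord c (qe e s) - coord c (qe e t))
    (coord c (q s) - coord c (q t)).
  by move: h1 h2; rewrite /eta; lra.
Qed.

(** [pairing_estimate] with [k] equal to [tube_slope * e]. The constant [D] is fixed before [e], so
    the error is quadratic uniformly in small [e]. *)
Lemma first_order_in_tube :
  exists D : R, forall e, 0 < e < e0 -> e < r / (2 * tube_slope) ->
  dom c (qe e a) -> `|coord c (qe e a) - coord c (q a)| <= C0' * e ->
  forall t, a <= t <= b ->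
  `|z t (tangent_of_coord c (q t) (coord c (qe e t) - coord c (q t))) -
    z a (tangent_of_coord c (q a) (coord c (qe e a) - coord c (q a))) -
    e * (J t - J a)| <= D * e ^+ 2.
Proof.
pose P (j : 'I_n) t := z t (tangent_of_coord c (q t) (delta_mx 0 j)).
have Pac j : abs_continuous a b (P j) by have [] := z_evol abc (delta_mx 0 j).
have /choice[Q HQ] : forall j, exists Q, 0 <= Q /\ forall t, a <= t <= b -> `|P j t| <= Q.
  by move=> j; have [Q] := abs_continuous_bounded (Pac j); exists Q.
pose QQ := \sum_j Q j.
have QQ0 : 0 <= QQ by apply: sumr_ge0 => j _; have [] := HQ j.
have PQQ j t : a <= t <= b -> `|P j t| <= QQ.
  move=> tab; apply: (@le_trans _ _ (Q j)); first by have [_] := HQ j; apply.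
  rewrite /QQ (bigD1 j)//= lerDl; apply: sumr_ge0 => i _; by have [] := HQ i.
have pairE t w : a <= t <= b ->
    z t (tangent_of_coord c (q t) w) = \sum_j P j t * w 0 j.
  by move=> tab; apply: covector_coord; [exact/z_cov/tT|exact: qc].
have S0 := tube_slope_gt0.
pose D1 := n%:R * QQ * C * tube_slope ^+ 2.
pose D2 := l%:R * K * (n%:R * QQ) * L * tube_slope.
have D10 : 0 <= D1 by rewrite !mulr_ge0 ?(ltW S0).
have D20 : 0 <= D2 by rewrite !mulr_ge0 ?(ltW S0).
exists (D1 * (W b - W a) + D2 * (b - a)) => e ee er da le t tab.
have e_gt0 : 0 < e by case/andP: ee.
have H := tube ee er da le.
have /andP[at_ tb] := tab.
have sab s : a <= s <= t -> a <= s <= b by move=> /andP[-> /le_trans->].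
have [xac xder] := chart_solution q_traj tab (fun s st => qc (sab s st)).
have [xeac xeder] := chart_solution (qe_traj ee) tab (fun s st => (H s (sab s st)).1).
have x_r s : a <= s <= t -> `|coord c (q s) - y0| <= r.
  move=> /sab /x_ball /le_trans; apply; rewrite ler_pdivrMr// ler_pMr// ?ler1n//.
have xe_r s : a <= s <= t -> `|coord c (qe e s) - y0| <= r.
  by move=> st; apply: tube_ball er (sab s st) (H s (sab s st)).2.
have P_der j : {ae (@lebesgue_measure R), forall s, a <= s <= t ->
    is_derive s 1 (P j) (- \sum_i u i s * \sum_k P k s *
      ('d (F i) (coord c (q s)) (delta_mx 0 j)) 0 k)}.
  have [_] := z_evol abc (delta_mx 0 j).
  move=> /ae_sub; apply => s Hs st.
  rewrite (eq_bigr (fun i => u i s * z s (tangent_of_coord c (q s)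
           ('d (fun y => X i (param c y) c) (coord c (q s)) (delta_mx 0 j))))).
    exact/Hs/sab.
  by move=> i _; congr (_ * _); apply/esym/pairE/sab.
have vP i s : a <= s <= t -> v i s = \sum_k P k s * (F i (coord c (q s))) 0 k.
  move=> /sab st; rewrite vE; last exact: tT.
  rewrite -pairE// /F coordK; last exact: qc.
  by congr (z s _); apply/esym/tangent_of_coordE; [exact: qc|have [] := X_smooth i].
have DFE i y h : `|y - y0| <= r ->
    'd (F i) y h = \sum_j h 0 j *: 'd (F i) y (delta_mx 0 j).
  move=> yr; have dF := F_diff i yr; rewrite (diff_row_sum h dF).
  by apply: eq_bigr => j _; congr (_ *: _); exact: deriveE.
have := pairing_estimate L0 C0 F_lipschitz F_taylor
  DFE at_ (ltW e_gt0)
  (mulr_ge0 (ltW S0) (ltW e_gt0)) K0 (fun i s st => v_bounded i (tT (sab s st)))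
  x_r xe_r (fun s st => (H s (sab s st)).2) xac xeac
  (abs_continuousS a0 (le_trans tb bT) W_ac) xder xeder (ae_restrict tb W_derive)
  QQ0 (fun j s st => PQQ j s (sab s st)) (fun j => abs_continuousS (lexx a) tb (Pac j))
  (abs_continuousS a0 (le_trans tb bT) J_ac) P_der (ae_restrict tb J_derive) vP.
rewrite /= -pairE// -pairE ?lexx// => /le_trans; apply.
have h1 : n%:R * QQ * C * (tube_slope * e) ^+ 2 * (W t - W a) <= D1 * (W b - W a) * e ^+ 2.
  have -> : n%:R * QQ * C * (tube_slope * e) ^+ 2 * (W t - W a) = D1 * e ^+ 2 * (W t - W a).
    by rewrite /D1; ring.
  rewrite mulrAC; apply: ler_wpM2r; first exact: exprn_ge0 (ltW e_gt0).
  apply: ler_wpM2l => //; apply: lerB => //.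
  by apply: W_nondecreasing => //; exact: le_trans a0 at_.
have h2 : e * (l%:R * K * (n%:R * QQ) * L * (tube_slope * e)) * (t - a) <= D2 * (b - a) * e ^+ 2.
  have -> : e * (l%:R * K * (n%:R * QQ) * L * (tube_slope * e)) * (t - a) = D2 * e ^+ 2 * (t - a).
    by rewrite /D2; ring.
  rewrite mulrAC; apply: ler_wpM2r; first exact: exprn_ge0 (ltW e_gt0).
  by apply: ler_wpM2l => //; rewrite lerD2r.
by apply: (le_trans (lerD h1 h2)); rewrite mulrDl.
Qed.

End Tube.

Lemma first_order_step t : first_order q z J qe c a -> a <= t <= b ->
  first_order q z J qe c t.
Proof.
move=> [C' [e1 [C'0 e10 close asym]]] tab.
have S0 := tube_slope_gt0 C'0; set S := tube_slope C' in S0.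
have [D HD] := first_order_in_tube C'0.
have rS : 0 < r / (2 * S) by rewrite divr_gt0// mulr_gt0.
exists S, (Num.min (Num.min e0 e1) (r / (2 * S))); split.
- exact: ltW.
- by rewrite !lt_min e0_gt0 e10.
- move=> e /andP[e_gt0]; rewrite !lt_min => /andP[/andP[ee0 ee1] er].
  have [|da le] := close e; first by rewrite e_gt0.
  by apply: tube => //; rewrite e_gt0.
move=> eta eta0; have [|e2 e20 He2] := asym (eta / 2); first by rewrite divr_gt0.
have D1 : 0 < `|D| + 1 by rewrite ltr_wpDl.
(* The last bound turns [D * e ^+ 2] into at most [eta / 2 * e]; the other half of [eta] is spent on
   the expansion at [a]. *)
exists (Num.min (Num.min (Num.min e0 e1) (r / (2 * S))) (Num.min e2 (eta / 2 / (`|D| + 1)))).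
  by rewrite !lt_min e0_gt0 e10 rS e20 !divr_gt0.
move=> e /andP[e_gt0]; rewrite !lt_min => /andP[/andP[/andP[ee0 ee1] er] /andP[ee2]].
rewrite ltr_pdivlMr// => eD.
have [|da le] := close e; first by rewrite e_gt0.
have [|H1 H2] := (HD e _ er da le t tab, He2 e); first by rewrite e_gt0.
have {}H2 := H2 _; rewrite e_gt0 ee2 in H2; have {}H2 := H2 isT.
move: H1 H2; move: (z t _) (z a _) => p1 p2 H1 H2.
have -> : p1 - e * J t = (p1 - p2 - e * (J t - J a)) + (p2 - e * J a) by ring.
apply: (le_trans (ler_normD _ _)); apply: (le_trans (lerD H1 H2)).
have : D * e ^+ 2 <= eta / 2 * e.
  rewrite expr2 mulrA; apply: ler_wpM2r; first exact: ltW.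
  apply: le_trans (ltW eD); rewrite mulrC; apply: ler_wpM2l; first exact: ltW.
  by rewrite (le_trans (ler_norm _))// lerDl.
lra.
Qed.

End InChart.

Lemma first_order_start c : q 0 = q0 -> J 0 = 0 -> 0 <= T -> dom c (q 0) ->
  first_order q z J qe c 0.
Proof.
move=> q00 J0 T0 cq.
have qe0 e : 0 < e < e0 -> coord c (qe e 0) - coord c (q 0) = 0.
  by move=> /qe_traj[-> _ _]; rewrite q00 subrr.
exists 0, e0; split => //.
  move=> e ee; rewrite qe0// normr0 mul0r; split => //.
  by have [-> _ _] := qe_traj ee; rewrite -q00.
move=> eta eta0; exists e0 => // e ee; rewrite qe0// J0 mulr0 subr0.
rewrite covector0//; first by rewrite normr0 mulr_ge0// ltW//; case/andP: ee.
by apply: z_cov; rewrite lexx.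
Qed.

Lemma chart_constants (c : chart A) p : dom c p -> exists r L B C : R,
  let y0 := coord c p in
  let F := fun i y => X i (param c y) c in
  [/\ 0 < r, 0 <= L, 0 <= B & 0 <= C] /\
  [/\ forall y, `|y - y0| <= r -> (coord c @` dom c) y,
      forall i y y', `|y - y0| <= r -> `|y' - y0| <= r ->
        `|F i y' - F i y| <= L * `|y' - y|,
      forall i y, `|y - y0| <= r -> `|F i y| <= B,
      forall i y y', `|y - y0| <= r -> `|y' - y0| <= r ->
        `|F i y' - F i y - 'd (F i) y (y' - y)| <= C * `|y' - y| ^+ 2 &
      forall i y, `|y - y0| <= r -> differentiable (F i) y].
Proof.
move=> cp; pose y0 := coord c p; pose F := fun i y => X i (param c y) c.
have /nbhs_ballP[r' /= r'0 Hr'] : nbhs y0 (coord c @` dom c).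
  by apply: open_nbhs_nbhs; split; [exact: range_open|exists p].
(* Halved, so that the closed ball fits in the open one. *)
pose r := r' / 2; have r0 : 0 < r by rewrite divr_gt0.
have BU y : `|y - y0| <= r -> (coord c @` dom c) y.
  move=> yr; apply: Hr'; rewrite -ball_normE /ball_/= distrC.
  by apply: (le_lt_trans yr); rewrite /r; lra.
have Fs i : smooth_on (coord c @` dom c) (F i) by have [_] := X_smooth i; apply.
have /choice[L HL] : forall i, exists L, 0 <= L /\ forall y y', `|y - y0| <= r ->
    `|y' - y0| <= r -> `|F i y' - F i y| <= L * `|y' - y|.
  by move=> i; have [L] := C1_lipschitz_cball (ltW r0) BU (Fs i 1); exists L.
have /choice[B HB] : forall i, exists B, 0 <= B /\ forall y, `|y - y0| <= r ->
    `|F i y| <= B.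
  by move=> i; have [B] := continuous_bounded_cball (ltW r0) BU (Fs i 0); exists B.
have /choice[C HC] : forall i, exists C, 0 <= C /\ forall y y', `|y - y0| <= r ->
    `|y' - y0| <= r -> `|F i y' - F i y - 'd (F i) y (y' - y)| <= C * `|y' - y| ^+ 2.
  by move=> i; have [C] := C2_taylor_cball (ltW r0) BU (Fs i 2); exists C.
have le_sum (f : 'I_l -> R) i : (forall j, 0 <= f j) -> f i <= \sum_j f j.
  by move=> f0; rewrite (bigD1 i)//= lerDl; exact: sumr_ge0.
have L0 i : 0 <= L i by have [] := HL i.
have B0 i : 0 <= B i by have [] := HB i.
have C0 i : 0 <= C i by have [] := HC i.
exists r, (\sum_i L i), (\sum_i B i), (\sum_i C i); split.
  by split => //; exact: sumr_ge0.
split => //.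
- move=> i y y' yr y'r; have [_ /(_ y y' yr y'r) H] := HL i.
  by apply: (le_trans H); apply: ler_wpM2r => //; exact: le_sum.
- move=> i y yr; have [_ /(_ y yr) H] := HB i.
  by apply: (le_trans H); exact: le_sum.
- move=> i y y' yr y'r; have [_ /(_ y y' yr y'r) H] := HC i.
  by apply: (le_trans H); apply: ler_wpM2r; [exact: exprn_ge0|exact: le_sum].
- by move=> i y yr; have [H _] := Fs i 1; apply/H/BU.
Qed.

(** Uniform continuity of [W] gives the length of the step. The neighbourhood of [t] is two-sided:
    real induction needs it to leave [t] as well as to arrive at [t]. *)
Lemma first_order_local t : 0 <= t <= T -> exists c d, [/\ 0 < d,
  forall s, 0 <= s <= T -> `|s - t| < d -> dom c (q s) &
  forall s s', 0 <= s -> s <= s' -> s' <= T -> `|s - t| < d -> `|s' - t| < d ->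
    first_order q z J qe c s -> first_order q z J qe c s'].
Proof.
move=> tT; have [c cq] := dom_cover A (q t).
have [r [L [B [C [[r0 L0 B0 C0] [BU FL FB FC FD]]]]]] := chart_constants cq.
have [_ cq' _] := q_traj.
have r2 : 0 < r / 2 by rewrite divr_gt0.
have [d1 d10 H1] := within_continuous_nbhs cq' tT (near_coord cq r2).
have L1 : 0 < 4 * (L + 1) by rewrite mulr_gt0// ltr_wpDl.
(* [W s] and [W s'] each differ from [W t] by less than this, so [L] times their difference is at
   most 1/2. *)
have iL1 : 0 < (4 * (L + 1))^-1 by rewrite invr_gt0.
have [d2 d20 H2] := abs_continuous_unif W_ac iL1.
exists c, (Num.min d1 d2); split; first by rewrite lt_min d10.
  by move=> s sT; rewrite lt_min => /andP[s1 _]; have [] := H1 s sT s1.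
move=> s s' s0 ss' s'T; rewrite !lt_min => /andP[sd1 sd2] /andP[sd1' sd2'] fs.
have sT : 0 <= s <= T by rewrite s0 (le_trans ss').
have s'T' : 0 <= s' <= T by rewrite s'T (le_trans s0).
have mid x : s <= x <= s' -> 0 <= x <= T /\ `|x - t| < d1.
  move=> /andP[sx xs']; rewrite (le_trans s0)//= (le_trans xs')//; split => //.
  move: sd1 sd1'; rewrite !ltr_norml => /andP[h1 h2] /andP[h3 h4].
  by apply/andP; split; lra.
have inc : in_chart T q c s s'.
  by split => // x /mid[xT xd]; have [] := H1 x xT xd.
apply: (first_order_step inc r0 BU _ L0 B0 C0 FL FB FC FD _ fs); last by rewrite ss' lexx.
  by move=> x /mid[xT xd]; have [_ /ltW] := H1 x xT xd.
have W1 := ltW (H2 t s tT sT sd2); have W2 := ltW (H2 t s' tT s'T' sd2').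
have : W s' - W s <= 2 * (4 * (L + 1))^-1.
  by move: W1 W2; rewrite !ler_norml => /andP[h1 h2] /andP[h3 h4]; lra.
move=> /(ler_wpM2l L0) /le_trans; apply.
have L1' : 0 < L + 1 by rewrite ltr_wpDl.
have -> : L * (2 * (4 * (L + 1))^-1) = 1 / 2 * (L / (L + 1)) by field; rewrite gt_eqF.
rewrite -[leRHS]mulr1; apply: ler_wpM2l => //.
by rewrite ler_pdivrMr// mul1r lerDl.
Qed.

(** The induction claims the expansion in every chart at [q t], so that each step may work in the
    chart supplied by [first_order_local] and translate the result by [first_order_transition]. *)
Lemma first_order_trajectory t c : J 0 = 0 -> 0 <= t <= T -> dom c (q t) ->
  first_order q z J qe c t.
Proof.
move=> J0 tT; have T0 : 0 <= T by case/andP: tT => /le_trans; apply.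
move: t tT c; apply: real_induction.
- by move=> c; apply: first_order_start => //; have [] := q_traj.
- move=> t /andP[t0 tT] H; have tT' : 0 <= t <= T by rewrite t0 ltW.
  have [c [d [d0 dq Hd]]] := first_order_local tT'.
  exists d => // s /andP[ts sT] std c' c's.
  have sd : `|s - t| < d by rewrite ger0_norm ?subr_ge0 ?(ltW ts)//; lra.
  have td : `|t - t| < d by rewrite subrr normr0.
  have sT' : 0 <= s <= T by rewrite sT (le_trans t0)// ltW.
  apply: (first_order_transition (z_cov sT') (dq s sT' sd)) => //.
  apply: (Hd t s t0 (ltW ts) sT td sd).
  by apply: H; [rewrite t0 lexx|exact: dq].
- move=> t /andP[t0 tT] H c' c't; have tT' : 0 <= t <= T by rewrite tT ltW.
  have [c [d [d0 dq Hd]]] := first_order_local tT'.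
  pose s := Num.max 0 (t - d / 2).
  have st : s < t by rewrite gt_max t0 /=; lra.
  have s0 : 0 <= s by rewrite le_max lexx.
  have sd' : t - d / 2 <= s by rewrite le_max lexx orbT.
  have sd : `|s - t| < d by rewrite ler0_norm ?subr_le0 ?(ltW st)//; lra.
  have td : `|t - t| < d by rewrite subrr normr0.
  have sT' : 0 <= s <= T by rewrite s0 (le_trans (ltW st)).
  apply: (first_order_transition (z_cov tT') (dq t tT' td)) => //.
  apply: (Hd s t s0 (ltW st) tT sd td).
  by apply: H; [rewrite s0|exact: dq].
Qed.

End ChartStep.

(** * Annihilating covectors *)

Section Annihilator.
Context {R : realType} {V : lmodType R} {n : nat}.

(** [V] may have infinite dimension, as the space of controls does. The image of [f] is therefore
    captured by a matrix [G] whose rows are values of [f], free and as many as possible. *)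
Lemma linear_nonsurjective_annihilator (f : V -> 'rV[R]_n) :
  (forall k v w, f (k *: v + w) = k *: f v + f w) ->
  ~ (forall y, exists v, f v = y) ->
  exists phi : 'rV[R]_n, phi != 0 /\ forall v, \sum_a phi 0 a * f v 0 a = 0.
Proof.
move=> flin fns.
have f0 : f 0 = 0.
  by have := flin (-1) 0 0; rewrite scaler0 addr0 scaleN1r addNr.
have span m (G : 'M[R]_(m, n)) : (forall i, exists v, f v = row i G) ->
    forall x : 'rV[R]_m, exists v, f v = x *m G.
  move=> /choice[g gE] x; exists (\sum_i x 0 i *: g i).
  have fD v w : f (v + w) = f v + f w by have := flin 1 v w; rewrite !scale1r.
  rewrite mulmx_sum_row (big_morph f fD f0); apply: eq_bigr => i _.
  by have := flin (x 0 i) (g i) 0; rewrite f0 !addr0 gE.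
pose free m := `[< exists G : 'M[R]_(m, n),
  row_free G /\ forall i, exists v, f v = row i G >].
have free0 : exists m, free m.
  exists 0%N; apply/asboolP; exists 0; split; last by case.
  by rewrite /row_free mxrank0.
have freen m : free m -> (m <= n)%N.
  by move=> /asboolP[G [/eqP Gf _]]; have := rank_leq_col G; rewrite Gf.
have [m /asboolP[G [Gfree Gf]] mmax] := ex_maxnP free0 freen.
have mn : (m < n)%N.
  rewrite ltn_neqAle freen ?andbT; last by apply/asboolP; exists G.
  (* With [n] free rows, [G] would have full rank and every vector would be a combination of values
     of [f]. *)
  apply/eqP => mnE; apply: fns => y; have [v vE] := span m G Gf (y *m pinvmx G).
  exists v; rewrite vE mulmxKpV// submx_full// /row_full.
  by move/eqP: Gfree => ->; rewrite mnE.
have inG v : (f v <= G)%MS.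
  (* A value outside the row space could be appended to [G], against maximality. *)
  apply: contraT => nG; suff /mmax : free (m + 1)%N by rewrite addn1 ltnn.
  apply/asboolP; exists (col_mx G (f v)); split; last first.
    move=> i; case: (split_ordP i) => j ->.
      by rewrite rowKu; exact: Gf.
    by exists v; rewrite rowKd row_id.
  have lt : (\rank G < \rank (G + f v)%MS)%N.
    by apply: rank_ltmx; rewrite /ltmx addsmxSl addsmx_sub submx_refl.
  rewrite /row_free eqn_leq rank_leq_row -addsmxE addn1.
  by move: lt; rewrite (eqP Gfree).
(* [G] has fewer than [n] rows, so some nonzero [phi] is orthogonal to all of them. *)
have : kermx G^T != 0.
  rewrite kermx_eq0 /row_free; apply: contraTneq mn => rk.
  by rewrite -leqNgt -rk; exact: rank_leq_col.
move=> /rowV0Pn[phi /sub_kermxP phiG phi0]; exists phi; split => // v.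
have /submxP[x ->] := inG v.
have -> : \sum_a phi 0 a * (x *m G) 0 a = (phi *m (x *m G)^T) 0 0.
  by rewrite mxE; apply: eq_bigr => a _; rewrite [in RHS]mxE.
by rewrite trmx_mul mulmxA phiG mul0mx mxE.
Qed.

End Annihilator.

Section Pairing.
Context {R : realType}.

Lemma is_derive_pairing n (phi : 'rV[R]_n) (g : R -> 'rV[R]_n) (t : R) (d : 'rV[R]_n) :
  is_derive t 1 g d ->
  is_derive t 1 (fun s => \sum_a phi 0 a * g s 0 a) (\sum_a phi 0 a * d 0 a).
Proof.
move=> /is_derive1_approx dg; apply: derive1_approx_at => e e0.
pose S := \sum_a `|phi 0 a|; have S0 : 0 <= S by exact: sumr_ge0.
have S1 : 0 < S + 1 by rewrite ltr_wpDl.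
have [r r0 H] := dg _ (divr_gt0 e0 S1); exists r => // s /H {}H.
rewrite -[_ *: _]/(_ * _) mulr_sumr -!sumrB.
apply: (@le_trans _ _ (S * `|g s - g t - (s - t) *: d|)).
  apply: (le_trans (ler_norm_sum _ _ _)); rewrite mulr_suml; apply: ler_sum => a _.
  have -> : phi 0 a * g s 0 a - phi 0 a * g t 0 a - (s - t) * (phi 0 a * d 0 a) =
    phi 0 a * (g s - g t - (s - t) *: d) 0 a by rewrite !mxE; ring.
  by rewrite normrM ler_wpM2l// coord_le_norm.
apply: (@le_trans _ _ ((S + 1) * (e / (S + 1) * `|s - t|))).
  by apply: ler_pM => //; rewrite lerDl.
by rewrite mulrA mulrCA divff ?gt_eqF// mulr1.
Qed.

Lemma abs_continuous_pairing n (phi : 'rV[R]_n) (g : R -> 'rV[R]_n) (a b : R) :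
  abs_continuous a b g -> abs_continuous a b (fun s => \sum_j phi 0 j * g s 0 j).
Proof.
move=> acg; apply: abs_continuous_sum => j.
apply: (@abs_continuous_linear _ _ _ _ _ _ `|phi 0 j| 0 g g) => // x y _ _ _.
rewrite -mulrBr normrM mul0r addr0; apply: ler_wpM2l => //.
have -> : g y 0 j - g x 0 j = (g y - g x) 0 j by rewrite !mxE.
exact: coord_le_norm.
Qed.

End Pairing.

(** * Regularity in time of the pairing of the covector with the vector fields *)

Section VelocityPairing.
Context {R : realType} {n l : nat} {M : topologicalType}.
Variables (A : smooth_manifold R n M) (X : 'I_l -> M -> chart A -> 'rV[R]_n).
Variables (T : R) (q0 : M) (u : control l T) (q : R -> M).
Variable (z : R -> (chart A -> 'rV[R]_n) -> R).
Hypothesis X_smooth : forall i, smooth_vector_field (X i).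
Hypothesis T0 : 0 <= T.
Hypothesis q_traj : trajectory X q0 u q.
Hypothesis z_cov : forall t, 0 <= t <= T -> cotangent_space (q t) (z t).
Hypothesis z_ac : forall c s r, in_chart T q c s r -> forall w,
  abs_continuous s r (fun t => z t (tangent_of_coord c (q t) w)).

(** In a chart the pairing is a finite sum of products: coordinates of the covector, absolutely
    continuous by the evolution equation, times a Lipschitz function of the absolutely continuous
    curve. *)
Lemma velocity_pairing_ac t : 0 <= t <= T -> exists2 d, 0 < d &
  forall s s', 0 <= s -> s <= s' -> s' <= T -> `|s - t| < d -> `|s' - t| < d ->
  forall i, abs_continuous s s' (fun x => z x (X i (q x))).
Proof.
move=> tT; have [c cq] := dom_cover A (q t).
have [r [L [B [C [[r0 L0 _ _] [_ FL _ _ _]]]]]] := chart_constants X_smooth cq.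
have [_ cq' q_ac] := q_traj.
have [d d0 H] := within_continuous_nbhs cq' tT (near_coord cq r0).
exists d => // s s' s0 ss' s'T sd sd' i.
have mid x : s <= x <= s' -> 0 <= x <= T /\ `|x - t| < d.
  move=> /andP[sx xs']; rewrite (le_trans s0)//= (le_trans xs')//; split => //.
  move: sd sd'; rewrite !ltr_norml => /andP[h1 h2] /andP[h3 h4].
  by apply/andP; split; lra.
have qc x : s <= x <= s' -> dom c (q x) /\ `|coord c (q x) - coord c (q t)| <= r.
  by move=> /mid[xT xd]; have [? /ltW] := H x xT xd.
have inc : in_chart T q c s s' by split => // x /qc[].
have [x_ac _] := q_ac c s s' inc.
pose F y := X i (param c y) c.
have hE x : s <= x <= s' -> z x (X i (q x)) =
    \sum_j z x (tangent_of_coord c (q x) (delta_mx 0 j)) * F (coord c (q x)) 0 j.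
  move=> sx; have [cx _] := qc x sx; have [xT _] := mid x sx.
  rewrite -(covector_coord (z_cov xT) cx) /F coordK//.
  by congr (z x _); apply/esym/tangent_of_coordE => //; have [] := X_smooth i.
have F_ac j : abs_continuous s s' (fun x => F (coord c (q x)) 0 j).
  apply: (@abs_continuous_linear _ _ _ _ _ _ L 0 (coord c \o q) (coord c \o q)) => // x y sx xy ys'.
  rewrite mul0r addr0.
  have -> : F (coord c (q y)) 0 j - F (coord c (q x)) 0 j =
    (F (coord c (q y)) - F (coord c (q x))) 0 j by rewrite !mxE.
  apply: (le_trans (coord_le_norm _ _)).
  have [|_ h1] := qc x; first by rewrite sx (le_trans xy).
  have [|_ h2] := qc y; first by rewrite ys' (le_trans sx).
  exact: FL.
have sum_ac : abs_continuous s s' (fun x => \sum_j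
    z x (tangent_of_coord c (q x) (delta_mx 0 j)) * F (coord c (q x)) 0 j).
  by apply: abs_continuous_sum => j; apply: abs_continuousM => //; exact: z_ac.
apply: (@abs_continuous_linear _ _ _ _ _ _ 1 0 _ _ _ _ _ _ sum_ac sum_ac) => // x y sx xy ys'.
by rewrite mul0r addr0 mul1r !hE// ?sx ?ys' ?andbT//= ?(le_trans xy) ?(le_trans sx).
Qed.

Lemma velocity_pairing_continuous i t : 0 <= t <= T -> forall e, 0 < e ->
  exists2 d, 0 < d & forall s, 0 <= s <= T -> `|s - t| < d ->
    `|z s (X i (q s)) - z t (X i (q t))| < e.
Proof.
move=> tT e e0; have [d d0 H] := velocity_pairing_ac tT.
have /andP[t0 tT'] := tT.
pose s1 := Num.max 0 (t - d / 2); pose s2 := Num.min T (t + d / 2).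
have s1t : s1 <= t by rewrite ge_max t0 /=; lra.
have s2t : t <= s2 by rewrite le_min tT' /=; lra.
have s10 : 0 <= s1 by rewrite le_max lexx.
have s2T : s2 <= T by rewrite ge_min lexx.
have s1d : t - d / 2 <= s1 by rewrite le_max lexx orbT.
have s2d : s2 <= t + d / 2 by rewrite ge_min lexx orbT.
have ac : abs_continuous s1 s2 (fun x => z x (X i (q x))).
  apply: H => //; first exact: le_trans s1t s2t.
    by rewrite ler0_norm ?subr_le0//; lra.
  by rewrite ger0_norm ?subr_ge0//; lra.
have [d' d'0 H'] := abs_continuous_unif ac e0.
exists (Num.min d' (d / 2)); first by rewrite lt_min d'0 divr_gt0.
move=> s /andP[s0 sT]; rewrite lt_min => /andP[sd']; rewrite ltr_norml => /andP[h1 h2].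
apply: H' => //; first by rewrite s1t.
by rewrite ge_max le_min s0 sT /=; apply/andP; split; lra.
Qed.

(** The nearest-point projection onto [[0, T]]. Composing with it extends the pairing by its end
    values to a continuous function on the line. *)
Let clamp (t : R) : R := Num.max 0 (Num.min t T).

Let clamp_in t : 0 <= clamp t <= T.
Proof. by rewrite /clamp le_max lexx/= ge_max T0 ge_min lexx orbT. Qed.

Let clamp_id t : 0 <= t <= T -> clamp t = t.
Proof. by move=> /andP[t0 tT]; rewrite /clamp min_l// max_r. Qed.

Let clamp_lip s t : `|clamp s - clamp t| <= `|s - t|.
Proof.
have := ler_norm (s - t); have := ler_norm (t - s); rewrite (distrC t s).
move: T0; rewrite /clamp !maxEle !minEle ler_norml => ? ? ?.
case: (leP s T) => ?; case: (leP t T) => ?;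
  repeat (case: ifPn; rewrite -?ltNge => ?); apply/andP; split; lra.
Qed.

Lemma clamped_velocity_pairing i : exists h : R -> R,
  continuous h /\ forall t, 0 <= t <= T -> h t = z t (X i (q t)).
Proof.
exists (fun t => z (clamp t) (X i (q (clamp t)))); split; last first.
  by move=> t /clamp_id ->.
move=> t; apply/cvgrPdist_lt => e e0.
have [d d0 H] := velocity_pairing_continuous i (clamp_in t) e0.
apply/nbhs_ballP; exists d => //= s; rewrite /ball/= => st.
rewrite distrC; apply: H; first exact: clamp_in.
by rewrite (le_lt_trans (clamp_lip _ _))// distrC.
Qed.

End VelocityPairing.

(** * Continuous controls, their primitives and the norm of controls *)

Section Controls.
Context {R : realType}.

Lemma continuous_bounded_segment (f : R -> R) (a b : R) : continuous f ->
  exists2 K, 0 <= K & forall t, a <= t <= b -> `|f t| <= K.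
Proof.
move=> cf; have [ab|ba] := leP a b; last first.
  by exists 0 => // t /andP[at_ tb]; have := le_trans at_ tb; rewrite leNgt ba.
have [|c _ H] := @EVT_max R (fun t => `|f t|) a b ab.
  by apply: continuous_subspaceT => t; have cft := cf t; exact: cvg_norm cft.
by exists `|f c| => // t tab; apply: H; rewrite in_itv.
Qed.

Lemma continuous_L2 (T : R) (f : R -> R) : continuous f ->
  exists v : L2 T, forall t, 0 <= t <= T -> v t = f t.
Proof.
move=> cf; have [K K0 fK] := @continuous_bounded_segment f 0 T cf.
(* A continuous function on the line may be unbounded, so it is cut off outside [[0, T]]. *)
have mf : measurable_fun setT (f \_ `[0, T]).
  apply/(measurable_restrictT _ _).1 => //.
  apply: measurable_funTS; exact: continuous_measurable_fun.
have [|v vE] := @bounded_L2 R T K _ mf.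
  move=> t; rewrite patchE; case: ifPn => [|_]; last by rewrite normr0.
  by rewrite inE/= in_itv/= => /fK.
by exists v => t tT; rewrite -vE patchE mem_set//= in_itv.
Qed.

(** Used twice: for the clock [W], with the |u_i|, and for [J], with the squares of the components
    of [v]. *)
Lemma sum_primitive (T : R) (l : nat) (g : 'I_l -> R -> R) :
  (forall i, (@lebesgue_measure R).-integrable `[0, T] (EFin \o g i)) ->
  exists G : R -> R, [/\ G 0 = 0, abs_continuous 0 T G &
    {ae (@lebesgue_measure R), forall t, 0 <= t <= T ->
      is_derive t 1 G (\sum_i g i t)}].
Proof.
move=> intg; have /choice[G HG] := fun i => integrable_primitive (intg i).
exists (fun t => \sum_i G i t); split.
- by apply: big1 => i _; have [] := HG i.
- by apply: abs_continuous_sum => i; have [] := HG i.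
have /ae_forall_ord : forall i, {ae (@lebesgue_measure R), forall t, 0 <= t <= T ->
    is_derive t 1 (G i) (g i t)} by move=> i; have [] := HG i.
move=> /ae_sub; apply => t H tT.
have -> : (fun t => \sum_i G i t) = \sum_(i < l) G i by apply/funext => s; rewrite fct_sumE.
by apply: is_derive_sum => i; exact: H.
Qed.

Lemma control_norm_ge0 l (T : R) (v : control l T) : 0 <= control_norm v.
Proof. exact: sqrtr_ge0. Qed.

Lemma control_normZ l (T e : R) (v : control l T) : 0 <= e ->
  control_norm (e *: v) = e * control_norm v.
Proof.
move=> e0; rewrite /control_norm.
rewrite (eq_bigr (fun i => e ^+ 2 * (fine 'N[mrestr (@lebesgue_measure R) (measurable_itv `[0, T])]_2
                          [EFin \o v i]) ^+ 2)).
  by rewrite -mulr_sumr sqrtrM ?sqr_ge0// sqrtr_sqr ger0_norm.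
move=> i _; rewrite -exprMn; congr (_ ^+ 2).
have -> : EFin \o (e *: v) i = EFin \o (e \*: v i) by apply/funext.
by rewrite LnormZ fineM//= ?ger0_norm// -finite_norm_fine.
Qed.

End Controls.

(** [J] is nondecreasing, and a nonzero value of [h] would make it grow strictly near that time. The
    derivative only dominates [h t ^+ 2], so the lemma fits one component [h] of a sum of
    squares. *)
Lemma nonneg_primitive_eq0 (R : realType) (T : R) (h J : R -> R) :
  0 < T -> continuous h -> abs_continuous 0 T J ->
  {ae (@lebesgue_measure R), forall t, 0 <= t <= T ->
    exists2 d, h t ^+ 2 <= d & is_derive t 1 J d} ->
  J 0 = J T -> forall t, 0 <= t <= T -> h t = 0.
Proof.
move=> T_gt0 hc J_ac J_der JT t tT.
have J_nd s s' : 0 <= s -> s <= s' -> s' <= T -> J s <= J s'.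
  move=> s0 ss' s'T; apply: abs_continuous_nondecreasing ss'.
    exact: abs_continuousS J_ac.
  apply: ae_sub J_der _ => x H /andP[sx xs'].
  have [|d hd Jd] := H; first by rewrite (le_trans s0)//= (le_trans xs').
  by exists d => //; apply: le_trans hd; exact: sqr_ge0.
apply/eqP; apply: contraT => ht.
(* Near [t] the absolute value of [h] keeps at least half of its value at [t]. *)
pose m := h t ^+ 2 / 4.
have m0 : 0 < m by rewrite divr_gt0// lt_def sqrf_eq0 ht sqr_ge0.
have ht2 : 0 < `|h t| / 2 by rewrite divr_gt0// normr_gt0.
have /cvgrPdist_lt/(_ _ ht2)/nbhs_ballP[d /= d0 Hd] := hc t.
have hbig s : `|t - s| < d -> m <= h s ^+ 2.
  move=> /Hd; rewrite /m /= => hs.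
  have : `|h t| / 2 <= `|h s|.
    have := ler_normB (h t - h s) (- h s); rewrite opprK subrK normrN; lra.
  move=> h1; rewrite -(real_normK (num_real (h s))) -(real_normK (num_real (h t))).
  have -> : `|h t| ^+ 2 / 4 = (`|h t| / 2) ^+ 2 by field.
  by rewrite lerXn2r ?nnegrE// ltW.
have /andP[t0 tT'] := tT.
pose s1 := Num.max 0 (t - d / 2); pose s2 := Num.min T (t + d / 2).
have s1t : s1 <= t by rewrite ge_max t0 /=; lra.
have s2t : t <= s2 by rewrite le_min tT' /=; lra.
(* [0 < T] keeps the clipped interval nondegenerate even when [t] is an end point. *)
have s12 : s1 < s2 by rewrite gt_max !lt_min T_gt0 /=; apply/and3P; split; lra.
have s10 : 0 <= s1 by rewrite le_max lexx.
have s2T : s2 <= T by rewrite ge_min lexx.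
have s1d : t - d / 2 <= s1 by rewrite le_max lexx orbT.
have s2d : s2 <= t + d / 2 by rewrite ge_min lexx orbT.
have : J s1 - m * s1 <= J s2 - m * s2.
  apply: (@abs_continuous_nondecreasing _ s1 s2 (fun s => J s - m * s)); last exact: ltW.
    apply: (@abs_continuous_linear _ _ _ _ _ _ 1 m J (fun s => s)) => //; first exact: ltW.
    + move=> x y _ _ _; have -> : J y - m * y - (J x - m * x) = (J y - J x) - m * (y - x) by ring.
      by rewrite mul1r (le_trans (ler_normB _ _))// normrM (gtr0_norm m0).
    + exact: abs_continuousS J_ac.
    + exact: abs_continuous_id.
  apply: ae_sub J_der _ => s H /andP[s1s ss2].
  have [|g hg Jg] := H; first by rewrite (le_trans s10)//= (le_trans ss2).
  exists (1 * g + - m).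
    rewrite mul1r subr_ge0; apply: le_trans hg; apply: hbig.
    by rewrite ltr_norml; apply/andP; split; lra.
  have := is_derive_affine 1 (- m) Jg.
  by under eq_fun do rewrite mul1r mulNr.
have := J_nd 0 s1 (lexx _) s10 (le_trans (ltW s12) s2T).
have := J_nd s2 T (le_trans s10 (ltW s12)) s2T (lexx _).
have : 0 < m * (s2 - s1) by rewrite mulr_gt0// subr_gt0.
by rewrite -JT; lra.
Qed.

(** * The covector vanishes on the vector fields *)

Section AbnormalCovector.
Context {R : realType} {n l : nat} {M : topologicalType}.
Variables (A : smooth_manifold R n M) (X : 'I_l -> M -> chart A -> 'rV[R]_n).
Variables (T : R) (q0 : M) (u : control l T) (q : R -> M).
Variable Phi : 'I_n -> R -> (chart A -> 'rV[R]_n) -> R.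
Hypothesis X_smooth : forall i, smooth_vector_field (X i).
Hypothesis T_gt0 : 0 < T.
Hypothesis q_traj : trajectory X q0 u q.
Hypothesis Phi_def : is_Phi1 X u q Phi.
Variable phi : 'rV[R]_n.

Let z t v := \sum_a phi 0 a * Phi a t v.

Lemma combination_cotangent t : 0 <= t <= T -> cotangent_space (q t) (z t).
Proof.
move=> tT k v v' tv tv'; have [Pcov _ _] := Phi_def.
rewrite /z mulr_sumr -big_split/=; apply: eq_bigr => a _.
by rewrite (Pcov a t tT k v v' tv tv'); ring.
Qed.

Lemma combination_evolution c s r : in_chart T q c s r -> forall w,
  abs_continuous s r (fun t => z t (tangent_of_coord c (q t) w)) /\
  {ae (@lebesgue_measure R), forall t, s <= t <= r ->
    is_derive t 1 (fun t => z t (tangent_of_coord c (q t) w))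
      (- \sum_i u i t * z t (tangent_of_coord c (q t)
           ('d (fun y => X i (param c y) c) (coord c (q t)) w)))}.
Proof.
move=> inc w; have [_ _ Pevol] := Phi_def.
split.
  apply: abs_continuous_sum => a; have [Pac _] := Pevol c s r inc a w.
  apply: (@abs_continuous_linear _ _ _ _ _ _ `|phi 0 a| 0 _ _ _ _ _ _ Pac Pac) => // x y _ _ _.
  by rewrite -mulrBr normrM mul0r addr0.
have /ae_forall_ord := fun a => (Pevol c s r inc a w).2.
move=> /ae_sub; apply => t H st.
have -> : (fun t => z t (tangent_of_coord c (q t) w)) =
    \sum_(a < n) (phi 0 a *: (fun t => Phi a t (tangent_of_coord c (q t) w))).
  by apply/funext => x; rewrite fct_sumE.
have D : is_derive t 1 (\sum_(a < n) (phi 0 a *: (fun t => Phi a t (tangent_of_coord c (q t) w))))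
    (\sum_(a < n) phi 0 a *: (- \sum_i u i t * Phi a t (tangent_of_coord c (q t)
           ('d (fun y => X i (param c y) c) (coord c (q t)) w)))).
  by apply: is_derive_sum => a; apply: is_deriveZ; exact: H.
apply: is_derive_eq D _.
rewrite /z; under [in RHS]eq_bigr do rewrite mulr_sumr.
rewrite exchange_big/= -sumrN; apply: eq_bigr => a _.
rewrite scalerN; congr (- _); rewrite -[LHS]/(_ * _) mulr_sumr.
by apply: eq_bigr => i _; rewrite mulrCA.
Qed.

Variable D : {linear control l T -> (chart A -> 'rV[R]_n)}.
Hypothesis D_derivative : is_endpoint_derivative X q0 u (q T) D.
Hypothesis phi_D : forall v, z T (D v) = 0.

Lemma annihilated_endpoint_derivative t i : 0 <= t <= T -> z t (X i (q t)) = 0.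
Proof.
have T0 := ltW T_gt0.
have z_ac c s r (inc : in_chart T q c s r) w := (combination_evolution inc w).1.
have /choice[h hP] := clamped_velocity_pairing X_smooth T0 q_traj combination_cotangent z_ac.
have hc i' : continuous (h i') by have [] := hP i'.
have hE i' s : 0 <= s <= T -> h i' s = z s (X i' (q s)) by have [_] := hP i'; apply.
have /choice[v vh] := fun i' => continuous_L2 T (hc i').
have vE i' s (sT : 0 <= s <= T) : v i' s = z s (X i' (q s)).
  by rewrite vh// hE.
have /choice[K' HK'] : forall i', exists K, 0 <= K /\ forall s, 0 <= s <= T -> `|h i' s| <= K.
  by move=> i'; have [K] := continuous_bounded_segment 0 T (hc i'); exists K.
pose K := \sum_i K' i.
have K0 : 0 <= K by apply: sumr_ge0 => i' _; have [] := HK' i'.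
have v_bounded i' s : 0 <= s <= T -> `|v i' s| <= K.
  move=> sT; rewrite vh//; have [_ /(_ s sT) le] := HK' i'; apply: (le_trans le).
  by rewrite /K (bigD1 i')//= lerDl; apply: sumr_ge0 => j _; have [] := HK' j.
have [|W [_ W_ac W_der]] := @sum_primitive R T l (fun i' s => `|u i' s|).
  by move=> i'; have /integrable_abse := L2_integrable (u i').
have [|J [J0 J_ac J_der]] := @sum_primitive R T l (fun i' s => h i' s ^+ 2).
  move=> i'; apply: continuous_compact_integrable; first exact: segment_compact.
  apply: continuous_subspaceT => s; have hs := hc i' s.
  have -> : (fun s => h i' s ^+ 2) = h i' \* h i' by apply/funext => x; rewrite expr2.
  exact: (cvgM hs hs).
have {}J_der : {ae (@lebesgue_measure R), forall s, 0 <= s <= T ->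
    is_derive s 1 J (\sum_i v i s ^+ 2)}.
  apply: ae_sub J_der _ => s H sT; rewrite (eq_bigr (fun i => h i s ^+ 2)); first exact: H.
  by move=> j _; rewrite vh.
have [_ D_tangent D_approx] := D_derivative.
have [c cq] := dom_cover A (q T).
have [_ D_diff] := D_approx c cq.
pose N := control_norm v; have N0 : 0 <= N by exact: control_norm_ge0.
have N1 : 0 < N + 1 by rewrite ltr_wpDl.
have TT : 0 <= T <= T by rewrite T0 lexx.
have small d e : 0 < e < d / (N + 1) -> control_norm (e *: v) < d.
  move=> /andP[e0]; rewrite ltr_pdivlMr// control_normZ ?(ltW e0)//.
  by apply: le_lt_trans; rewrite ler_wpM2l ?(ltW e0)// lerDl.
(* The precision 1 is arbitrary: this instance serves only to provide end points, hence
   trajectories, for the controls near [u]. *)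
have [d1 d10 Hd1] := D_diff 1 ltr01.
pose e0 := d1 / (N + 1); have e0_gt0 : 0 < e0 by rewrite divr_gt0.
(* For [e] outside the range, [q] is a mere default value. *)
have /choice[qe qe_traj] : forall e, exists q' : R -> M, 0 < e < e0 ->
    trajectory X q0 (u + e *: v) q'.
  move=> e; have [ee|] := pselect (0 < e < e0); last by exists q.
  by have [[p' [q' q'_traj _]] _] := Hd1 _ (small _ _ ee); exists q'.
have [C [e1 [C0 e10 close asym]]] := first_order_trajectory q_traj
  combination_cotangent combination_evolution vE X_smooth K0 v_bounded
  W_ac W_der J_ac J_der e0_gt0 qe_traj J0 TT cq.
have [Kz Kz0 HKz] := covector_bound (combination_cotangent TT) cq.
have JT : J T = 0.
  apply/eqP; rewrite -normr_le0; apply/ler_addgt0Pr => eta eta0; rewrite add0r.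
  have [|e2 e20 He2] := asym (eta / 2); first by rewrite divr_gt0.
  have KN : 0 < Kz * N + 1 by rewrite ltr_wpDl// mulr_ge0.
  (* The remainder of the end-point derivative, of size [eta' * (e * N)], then contributes at most
     [eta / 2 * e] to the pairing; the other half is left to the expansion. *)
  pose eta' := eta / (2 * (Kz * N + 1)).
  have eta'0 : 0 < eta' by rewrite divr_gt0// mulr_gt0.
  have [d d0 Hd] := D_diff _ eta'0.
  pose e := Num.min (Num.min e0 e2) (d / (N + 1)) / 2.
  have m0 : 0 < Num.min (Num.min e0 e2) (d / (N + 1)).
    by rewrite !lt_min e0_gt0 e20 divr_gt0.
  have e_gt0 : 0 < e by rewrite divr_gt0.
  have : e < Num.min (Num.min e0 e2) (d / (N + 1)).
    by rewrite ltr_pdivrMr// ltr_pMr// ltr1n.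
  rewrite !lt_min => /andP[/andP[ee0 ee2] ed].
  have nd : control_norm (e *: v) < d by apply: small; rewrite e_gt0.
  have [_ /(_ (qe e T))[|dq]] := Hd _ nd.
    by exists (qe e) => //; apply: qe_traj; rewrite e_gt0.
  rewrite control_normZ ?(ltW e_gt0)// -/N.
  have -> : D (e *: v) c = e *: D v c by rewrite linearZ.
  set w := coord c (qe e T) - coord c (q T) => rest.
  (* The covector kills [D v], so the pairing sees only the remainder of the end-point
     derivative. *)
  have zw : z T (tangent_of_coord c (q T) w) =
      z T (tangent_of_coord c (q T) (w - e *: D v c)).
    rewrite -{1}(subrK (e *: D v c) w) addrC.
    rewrite (covector_linear (combination_cotangent TT) cq).
    by rewrite tangent_of_coordE// phi_D mulr0 add0r.
  have := He2 e; rewrite e_gt0 ee2 => /(_ isT); rewrite -/w zw.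
  have := le_trans (HKz (w - e *: D v c)) (ler_wpM2l Kz0 rest).
  move: (z T _) => p h1 h2.
  have h3 : `|e * J T| <= Kz * (eta' * (e * N)) + eta / 2 * e.
    rewrite -(subKr p (e * J T)); apply: (le_trans (ler_normB _ _)); exact: lerD.
  have h4 : Kz * (eta' * (e * N)) <= eta / 2 * e.
    have -> : eta / 2 * e = (Kz * N + 1) * (eta' * e) by rewrite /eta'; field; rewrite gt_eqF.
    have -> : Kz * (eta' * (e * N)) = Kz * N * (eta' * e) by ring.
    by rewrite ler_wpM2r ?lerDl// mulr_ge0 ?ltW.
  rewrite -(ler_pM2l e_gt0) -{1}(gtr0_norm e_gt0) -normrM.
  apply: (le_trans h3); apply: (le_trans (lerD h4 (lexx _))).
  by rewrite -mulrDl -splitr mulrC.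
move=> tT; rewrite -hE//.
apply: (nonneg_primitive_eq0 T_gt0 (hc i) J_ac _ (etrans J0 (esym JT)) tT).
apply: ae_sub J_der _ => s H sT; exists (\sum_j v j s ^+ 2); last exact: H.
by rewrite (bigD1 i)//= vh// lerDl; apply: sumr_ge0 => j _; exact: sqr_ge0.
Qed.

End AbnormalCovector.

Lemma annihilated_not_controllable (R : realType) (n l : nat) (M : topologicalType)
    (A : smooth_manifold R n M) (X : 'I_l -> M -> chart A -> 'rV[R]_n)
    (T : R) (q : R -> M) (Phi : 'I_n -> R -> (chart A -> 'rV[R]_n) -> R) (phi : 'rV[R]_n) :
  phi != 0 ->
  (forall t i, 0 <= t <= T -> \sum_a phi 0 a * Phi a t (X i (q t)) = 0) ->
  forall t, 0 <= t <= T -> ~ sigma1_controllable_at X T q Phi t.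
Proof.
move=> phi0 ann t /andP[t0 tT] /nbhs_ballP[r /= r0 Hr].
have phin : 0 < `|phi| by rewrite normr_gt0.
(* [k *: phi] has norm [r / 2], so it would be reachable, yet its pairing with [phi] is [k] times a
   positive sum of squares. *)
pose k := r / (2 * `|phi|); have k0 : 0 < k by rewrite divr_gt0// mulr_gt0.
have [|du [q1 [[q10 q1ac q1der] q1t]]] := Hr (k *: phi).
  rewrite -ball_normE /ball_/= sub0r normrN normrZ gtr0_norm// /k.
  have -> : r / (2 * `|phi|) * `|phi| = r / 2 by field; rewrite gt_eqF.
  by rewrite ltr_pdivrMr// ltr_pMr// ltr1n.
(* The pairing of [phi] with the solution has zero derivative almost everywhere, so the constant 0
   is a majorant. *)
have : `|\sum_a phi 0 a * q1 t 0 a - \sum_a phi 0 a * q1 0 0 a| <= 0 - 0.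
  apply: (@abs_continuous_le _ 0 t (fun s => \sum_a phi 0 a * q1 s 0 a) (fun=> 0)) => //.
  - by apply: abs_continuous_pairing; exact: abs_continuousS q1ac.
  - by move=> e e0; exists e => // m x y _ _ _; rewrite big1// => i _; rewrite subrr normr0.
  apply: ae_sub q1der _ => s H /andP[s0 st].
  have sT : 0 <= s <= T by rewrite s0 (le_trans st).
  exists (\sum_a phi 0 a * (\sum_i du i s *: Phi1_map Phi s (X i (q s))) 0 a), 0.
  split; [exact/is_derive_pairing/H|exact: is_derive_cst|].
  rewrite (eq_bigr (fun a => \sum_i du i s * (phi 0 a * Phi a s (X i (q s))))).
    by rewrite exchange_big/= big1 ?normr0// => i _; rewrite -mulr_sumr ann// mulr0.
  by move=> a _; rewrite summxE mulr_sumr; apply: eq_bigr => i _; rewrite !mxE mulrCA.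
rewrite q1t q10 (eq_bigr (fun a => k * phi 0 a ^+ 2)); last first.
  by move=> a _; rewrite mxE mulrCA expr2.
rewrite [X in _ - X]big1 ?subr0; last by move=> a _; rewrite mxE mulr0.
rewrite -mulr_sumr normr_le0 mulf_eq0 (gt_eqF k0)/= psumr_eq0; last first.
  by move=> a _; exact: sqr_ge0.
move=> /allP H; move/negP: phi0; apply; apply/eqP/rowP => a; rewrite mxE.
by apply/eqP; rewrite -sqrf_eq0; apply: H; rewrite mem_index_enum.
Qed.

Theorem lemma4p3 (R : realType) (n l : nat) (M : topologicalType)
    (A : smooth_manifold R n M) (X : 'I_l -> M -> chart A -> 'rV[R]_n)
    (T : R) (q0 : M) (u : control l T) (q : R -> M)
    (Phi : 'I_n -> R -> (chart A -> 'rV[R]_n) -> R)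
    (X_smooth : forall i, smooth_vector_field (X i))
    (X_indep : pointwise_independent X)
    (T_gt0 : 0 < T)
    (q_abnormal : abnormal X q0 u q)
    (Phi_def : is_Phi1 X u q Phi) :
  (forall t, 0 <= t <= T -> ~ sigma1_controllable_at X T q Phi t) /\
  (exists phi : 'rV[R]_n, phi != 0 /\
    forall t, 0 <= t <= T ->
      cotangent_space (q t) (fun v => \sum_a phi 0 a * Phi a t v) /\
      forall i, \sum_a phi 0 a * Phi a t (X i (q t)) = 0).
Proof.
have [q_traj [D D_der [_ D_proper]]] := q_abnormal.
have [c cq] := dom_cover A (q T).
have TT : 0 <= T <= T by rewrite (ltW T_gt0) lexx.
have [_ D_tangent _] := D_der.
have [Pcov _ _] := Phi_def.
pose f v : 'rV[R]_n := Phi1_map Phi T (D v).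
have f_linear k v w : f (k *: v + w) = k *: f v + f w.
  by apply/rowP => a; rewrite !mxE linearP; exact: (Pcov a T TT).
(* If [f] were onto, [Phi1_map Phi T] would map the tangent space onto a space of the same
   dimension, hence be injective there, and every tangent vector would be a value of [D]. *)
have f_proper : ~ (forall y, exists v, f v = y).
  move=> f_onto; apply: D_proper => w wT.
  (* The matrix of [Phi1_map Phi T] in the chart [c], acting on row vectors from the right. *)
  pose Q : 'M[R]_n := \matrix_(j, a) Phi a T (tangent_of_coord c (q T) (delta_mx 0 j)).
  have PhiE w' : tangent_space (q T) w' -> Phi1_map Phi T w' = w' c *m Q.
    move=> w'T; apply/rowP => a; rewrite !mxE -{1}(tangent_of_coordE cq w'T).
    rewrite (covector_coord (Pcov a T TT) cq).
    by apply: eq_bigr => j _; rewrite mxE mulrC.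
  (* Each row of the identity is a value of [f], hence lies in the row space of [Q]. *)
  have Q_unit : Q \in unitmx.
    rewrite -row_full_unit -sub1mx; apply/row_subP => i.
    have [v vE] := f_onto (row i 1%:M); rewrite -vE /f PhiE//; exact: submxMl.
  have [v vE] := f_onto (Phi1_map Phi T w).
  exists v => //; rewrite -(tangent_of_coordE cq (D_tangent v)) -(tangent_of_coordE cq wT).
  congr tangent_of_coord; apply: (can_inj (mulmxK Q_unit)).
  by rewrite -!PhiE.
have [phi [phi0 phiD]] := linear_nonsurjective_annihilator f_linear f_proper.
have ann t i : 0 <= t <= T -> \sum_a phi 0 a * Phi a t (X i (q t)) = 0.
  apply: (annihilated_endpoint_derivative X_smooth T_gt0 q_traj Phi_def D_der) => v.
  by rewrite -[RHS](phiD v); apply: eq_bigr => a _; rewrite mxE.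
split; first exact: annihilated_not_controllable ann.
exists phi; split=> // t tT; split=> [|i]; last exact: ann.
exact: combination_cotangent Phi_def phi t tT.
Qed.
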